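(* Let $n\ge 3$, $m\ge 1$ and let $h:\mathbb{B}^n\to\mathbb{B}^m$ be a harmonic or hyperbolic harmonic function. Then for every $x\in\mathbb{B}^n$, $$\big|\nabla|h|(x)\big|\le\begin{cases}\dfrac{n}{2}\,\dfrac{1-|h(x)|^2}{1-|x|} & \text{if } h \text{ is harmonic},\\[3mm] (n-1)\,\dfrac{1-|h(x)|^2}{1-|x|^2} & \text{if } h \text{ is hyperbolic harmonic}.\end{cases}$$ Furthermore, this inequality is strict for $n\ge 4$.
   Context: $\mathbb{B}^k$ is the open unit ball of $\mathbb{R}^k$, $\mathbb{S}^{n-1}$ the unit sphere of $\mathbb{R}^n$, and $|\cdot|$ the Euclidean norm. A real-valued function $u\in C^2(\mathbb{B}^n,\mathbb{R})$ is hyperbolic harmonic if $\Delta_h u=0$ on $\mathbb{B}^n$, where $$\Delta_h u(x)=(1-|x|^2)^2\Delta u(x)+2(n-2)(1-|x|^2)\sum_{i=1}^n x_i\frac{\partial u}{\partial x_i}(x)$$ and $\Delta$ is the Euclidean Laplacian. A vector-valued function is harmonic (resp. hyperbolic harmonic) if each of its components is. The quantity $\big|\nabla|h|(x)\big|$ is defined by $$\big|\nabla|h|(x)\big|=\sup_{\beta\in\mathbb{S}^{n-1}}\ \lim_{t\to0^+}\frac{\big|\,|h(x+t\beta)|-|h(x)|\,\big|}{t}.$$ *)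

(* Defs.v *)
From HB Require Import structures.
From mathcomp Require Import all_boot all_order all_algebra.
From mathcomp Require Import all_classical all_reals all_analysis.
Import Order.TTheory GRing.Theory Num.Theory.
Import numFieldNormedType.Exports.

Set Implicit Arguments.
Unset Strict Implicit.
Unset Printing Implicit Defensive.

Local Open Scope classical_set_scope.
Local Open Scope ring_scope.

Section Defs.
Context {R : realType}.

(* The library norm on 'rV[R]_n is the sup norm; it induces the same topology
   as [enorm], so continuity and differentiability are unaffected. *)
Definition enorm n (x : 'rV[R]_n) : R := Num.sqrt (\sum_(i < n) x 0 i ^+ 2).

Definition eball {n} : set 'rV[R]_n := [set x | enorm x < 1].

Definition esphere {n} : set 'rV[R]_n := [set x | enorm x = 1].

Definition basis_vec n (i : 'I_n) : 'rV[R]_n := delta_mx 0 i.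

Definition partial n (i : 'I_n) (u : 'rV[R]_n -> R) : 'rV[R]_n -> R :=
  'D_(basis_vec i) u.

(* Meaningful for open A: continuity and derivability are those of u at each point
   of A as a function on the whole space. *)
Fixpoint Ck_on k {n} (A : set 'rV[R]_n) (u : 'rV[R]_n -> R) : Prop :=
  (forall x, A x -> {for x, continuous u}) /\
  (if k is k'.+1 then
     forall i : 'I_n, (forall x, A x -> derivable u x (basis_vec i)) /\
                      Ck_on k' A (partial i u)
   else True).

Definition laplacian n (u : 'rV[R]_n -> R) (x : 'rV[R]_n) : R :=
  \sum_(i < n) partial i (partial i u) x.

Definition hyp_laplacian n (u : 'rV[R]_n -> R) (x : 'rV[R]_n) : R :=
  (1 - enorm x ^+ 2) ^+ 2 * laplacian u x +
  2 * (n%:R - 2) * (1 - enorm x ^+ 2) * \sum_(i < n) x 0 i * partial i u x.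

Definition harmonic n (u : 'rV[R]_n -> R) : Prop :=
  Ck_on 2 eball u /\ forall x, eball x -> laplacian u x = 0.

Definition hyp_harmonic n (u : 'rV[R]_n -> R) : Prop :=
  Ck_on 2 eball u /\ forall x, eball x -> hyp_laplacian u x = 0.

Definition vharmonic n m (h : 'rV[R]_n -> 'rV[R]_m) : Prop :=
  forall j : 'I_m, harmonic (fun x => h x 0 j).

Definition vhyp_harmonic n m (h : 'rV[R]_n -> 'rV[R]_m) : Prop :=
  forall j : 'I_m, hyp_harmonic (fun x => h x 0 j).

(* The limit exists for every beta when h is C^1 around x, including when
   h x = 0.  The supremum is taken in the extended reals so that no default
   value is involved for an unbounded set. *)
Definition abs_grad_norm n m (h : 'rV[R]_n -> 'rV[R]_m) (x : 'rV[R]_n)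
    : \bar R :=
  ereal_sup
    [set (lim (`|enorm (h (x + t *: beta)) - enorm (h x)| / t
               @[t --> 0^'+]))%:E
      | beta in esphere].

End Defs.

(* Main.v *)
Require Import Defs.
From HB Require Import structures.
From mathcomp Require Import all_boot all_order all_algebra.
From mathcomp Require Import all_classical all_reals all_analysis.
From mathcomp Require Import ring lra zify.
Import Order.TTheory GRing.Theory Num.Theory.
Import numFieldNormedType.Exports.

Local Open Scope classical_set_scope.
Local Open Scope ring_scope.

Set Implicit Arguments.
Unset Strict Implicit.
Unset Printing Implicit Defensive.

(** A single scalar inequality carries the theorem.  Let [f] be a function on
    the unit sphere with [|f| <= 1] and mean [a], and let [w] be a unit vector.
    Then the mean of [(x . w) f(x)] equals the mean of [(x . w + a) f(x)] minus
    [a^2], hence is at most the mean of [|x . w + a|] minus [a^2].  For [n = 3]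
    the coordinate [x . w] is uniform on [-1, 1] and this is [(1 - a^2) / 2];
    for [n >= 4] the coordinate is more concentrated and the bound improves by
    an amount depending only on [n] and [a] ([sphere_mean_abs],
    [moment_bound]).  The uniformity of the gain makes the final inequality
    strict even after a supremum over directions.

    Both kinds of harmonicity enter through the family of equations
    [(1 - k |y|^2) Lap v + 2 k (n - 2) y . grad v = 0], with [k = 0] or [k = 1].
    Over the sphere of radius [r], let [A(r)] be the mean of [v] and [M(r)] its
    first moment along [w].  The divergence theorem on spheres
    ([sphere_mean_div]) turns the equation into ordinary differential
    equations: [A] is constant, and [M] satisfies a first-order linear equation
    whose source term is the derivative of [v] at the origin along [w].
    If this derivative is positive, comparison with a linear function shows that
    it is at most [(n + k (n - 2)) M(r) / r]; letting [r] tend to 1, the scalar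
    inequality concludes at the origin ([gradient_bound_centre]).

    A general point is moved to the origin by a conformal map of the ball into
    itself ([gradient_bound_conformal]): a dilation followed by a translation
    in the harmonic case, the inversion that exchanges the point and the origin
    in the hyperbolic case when they differ.  For a vector-valued [h], the scalar function is
    the component of [h] along [h(x)], or along the derivative of [h] in the
    direction considered when [h(x) = 0] ([abs_grad_norm_le]).

    Surface measure is replaced by a positive linear functional.  Averages over
    finer and finer grids of a cube, taken to the limit along a free ultrafilter
    of the natural numbers, give a functional that is defined on all bounded
    functions and kills partial derivatives of continuously differentiable
    functions supported in the unit ball, because sums of difference quotients
    telescope ([cube_mean_partial]).  Radial weights that
    concentrate on the unit sphere then turn the cube mean into a sphere mean
    for which the divergence theorem holds, the only property of surface measure
    that the argument uses besides positivity. *)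

(** * The Euclidean inner product *)

Lemma cvg_sumr {R : realType} {T I : Type} (F : set_system T) {FF : Filter F}
    (r : seq I) (f : I -> T -> R) (a : I -> R) :
  (forall i, f i x @[x --> F] --> a i) ->
  (\sum_(i <- r) f i x) @[x --> F] --> \sum_(i <- r) a i.
Proof. by move=> h; apply: cvg_big => //; exact: add_continuous. Qed.

Section Basics.
Context {R : realType} {n : nat}.
Implicit Types (x y z : 'rV[R]_n) (A : set 'rV[R]_n).

Definition dot x y : R := \sum_i x 0 i * y 0 i.

Lemma dotC x y : dot x y = dot y x.
Proof. by apply: eq_bigr => i _; rewrite mulrC. Qed.

Lemma dotDl x y z : dot (x + y) z = dot x z + dot y z.
Proof. by rewrite -big_split; apply: eq_bigr => i _; rewrite mxE mulrDl. Qed.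

Lemma dotZl (a : R) x z : dot (a *: x) z = a * dot x z.
Proof. by rewrite big_distrr; apply: eq_bigr => i _ /=; rewrite mxE mulrA. Qed.

Lemma dot0l y : dot 0 y = 0.
Proof. by rewrite /dot big1 // => i _; rewrite mxE mul0r. Qed.

Lemma dotDr x y z : dot z (x + y) = dot z x + dot z y.
Proof. by rewrite !(dotC z) dotDl. Qed.

Lemma dotZr (a : R) x z : dot z (a *: x) = a * dot z x.
Proof. by rewrite !(dotC z) dotZl. Qed.

Lemma dot_ge0 x : 0 <= dot x x.
Proof. by apply: sumr_ge0 => i _; rewrite -expr2 sqr_ge0. Qed.

Lemma enorm_sqr x : enorm x ^+ 2 = dot x x.
Proof.
rewrite /enorm sqr_sqrtr; first by apply: eq_bigr => i _; rewrite expr2.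
by apply: sumr_ge0 => i _; rewrite sqr_ge0.
Qed.

Lemma enorm_ge0 x : 0 <= enorm x. Proof. exact: sqrtr_ge0. Qed.

Lemma eballE x : eball x <-> dot x x < 1.
Proof.
rewrite -enorm_sqr /eball /=; split => h.
  by rewrite expr_lt1 // enorm_ge0.
by rewrite -(@expr_lt1 _ 2) // enorm_ge0.
Qed.

Lemma esphereE x : esphere x -> dot x x = 1.
Proof. by rewrite -enorm_sqr /esphere /= => ->; rewrite expr1n. Qed.

Lemma dot_CS x y : dot x y ^+ 2 <= dot x x * dot y y.
Proof.
have H (a b : R) : 0 <= a ^+ 2 * dot x x + 2 * a * b * dot x y + b ^+ 2 * dot y y.
  have := dot_ge0 (a *: x + b *: y).
  rewrite !(dotDl, dotDr, dotZl, dotZr) (dotC y x) => h.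
  by apply: le_trans h _; rewrite le_eqVlt; apply/orP; left; apply/eqP; ring.
have := H (dot y y) (- dot x y); have := H (- dot x y) (dot x x).
have := dot_ge0 x; have := dot_ge0 y.
move: (dot x x) (dot y y) (dot x y) (H 1 1) (H 1 (-1)) => X Y c h1 h2 y0 x0 h3 h4.
have [X0|X0] := eqVneq X 0.
  have [Y0|Y0] := eqVneq Y 0; first by subst; nra.
  have : 0 < Y by rewrite lt_neqAle eq_sym Y0.
  by subst; nra.
have : 0 < X by rewrite lt_neqAle eq_sym X0.
nra.
Qed.

Lemma coord_sqr_le x i : x 0 i ^+ 2 <= dot x x.
Proof.
rewrite /dot (bigD1 i) //= -expr2 lerDl; apply: sumr_ge0 => j _.
by rewrite -expr2 sqr_ge0.
Qed.

Lemma coord_cont i : continuous (fun x : 'rV[R]_n => x 0 i).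
Proof. exact: coord_continuous. Qed.

Lemma dotr_cont y : continuous (fun x => dot x y).
Proof.
move=> x; have := @cvg_sumr R _ _ (nbhs x) _ (index_enum 'I_n) (fun i (z : 'rV[R]_n) => z 0 i * y 0 i); apply => i.
by apply: cvgMl; exact: coord_cont.
Qed.

Lemma dotxx_cont : continuous (fun x : 'rV[R]_n => dot x x).
Proof.
move=> x; have := @cvg_sumr R _ _ (nbhs x) _ (index_enum 'I_n) (fun i (z : 'rV[R]_n) => z 0 i * z 0 i); apply => i.
by apply: cvgM; exact: coord_cont.
Qed.

(** Indexed by the square of the radius, which keeps square roots out of the
    calculus. *)
Definition ballr (rho : R) := [set x | dot x x < rho].

Lemma ballr_open rho : open (ballr rho).
Proof. by apply: (@open_comp _ _ (fun x => dot x x) [set t | t < rho]); [move=> *; exact: dotxx_cont|exact: open_lt]. Qed.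

Lemma cball_compact : compact [set x | dot x x <= 1].
Proof.
apply: bounded_closed_compact; last first.
  apply: (@closed_comp _ _ (fun x => dot x x) [set t | t <= 1]); last exact: closed_le.
  by move=> *; exact: dotxx_cont.
exists 1; split => // M M1 x /= hx.
rewrite [leLHS]/Num.Def.normr /= mx_normrE; apply: bigmax_le => [|[i j] _ /=]; first lra.
rewrite ord1; have := coord_sqr_le x j => h.
have : x 0 j ^+ 2 <= 1 by exact: le_trans h hx.
by rewrite ler_norml; nra.
Qed.

End Basics.

(** * Functions with continuous partial derivatives *)

Section Lines.
Context {R : realType} {n : nat}.
Implicit Types (x y z w : 'rV[R]_n) (A : set 'rV[R]_n) (f g : 'rV[R]_n -> R).

Lemma is_derive_line f x w (s d : R) :
  is_derive (x + s *: w) w f d -> is_derive s 1 (fun t => f (x + t *: w)) d.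
Proof.
set g := fun t => _; move=> [dv vl].
have E : (fun h : R => h^-1 *: (g (h *: (1:R) + s) - g s)) =
         (fun h => h^-1 *: (f (h *: w + (x + s *: w)) - f (x + s *: w))).
  apply/funext => h; congr (_ *: (f _ - _)).
  by rewrite [h%:A]mulr1 scalerDl addrCA.
by apply: DeriveDef; rewrite /derivable /derive E //.
Qed.

Lemma is_derive_line0 f x w (d : R) :
  is_derive (0:R) 1 (fun t => f (x + t *: w)) d -> is_derive x w f d.
Proof.
set g := fun t => _; move=> [dv vl].
have E : (fun h : R => h^-1 *: (g (h *: (1:R) + 0) - g 0)) =
         (fun h => h^-1 *: (f (h *: w + x) - f x)).
  apply/funext => h; rewrite /g scale0r !addr0 [h%:A]mulr1.
  by rewrite (addrC x).
by apply: DeriveDef; rewrite /derivable /derive -E //.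
Qed.

Lemma is_derive_coord x w k : is_derive x w (fun z => z 0 k) (w 0 k).
Proof.
have lim : h^-1 *: (((h *: w + x) : 'rV[R]_n) 0 k - x 0 k) @[h --> 0^'] --> w 0 k.
  apply: cvg_near_cst; near=> h.
  have h0 : h != 0 by near: h; exact: nbhs_dnbhs_neq.
  by rewrite !mxE addrK /GRing.scale /= mulKf.
apply: DeriveDef; first by apply/cvg_ex; eexists; exact: lim.
by rewrite /derive; exact: cvg_lim lim.
Unshelve. all: by end_near. Qed.

End Lines.

Lemma mvt_abs {R : realType} (F dF : R -> R) (c : R) :
  (forall s : R, `|s| <= `|c| -> is_derive s 1 F (dF s)) ->
  exists2 xi, `|xi| <= `|c| & F c - F 0 = dF xi * c.
Proof.
move=> h.
have dr s : `|s| <= `|c| -> derivable F s 1 by move=> /h [].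
have [c0|c0] := leP 0 c.
  have [] := @MVT_segment R F dF 0 c c0.
  - move=> s; rewrite in_itv /= => /andP[s1 s2]; apply: h.
    by rewrite !ger0_norm //; exact: ltW.
  - apply: derivable_within_continuous => s; rewrite in_itv /= => /andP[s1 s2].
    by apply: dr; rewrite !ger0_norm.
  move=> xi; rewrite in_itv /= => /andP[s1 s2]; rewrite subr0 => ->.
  by exists xi => //; rewrite !ger0_norm.
have [] := @MVT_segment R F dF c 0 (ltW c0).
- move=> s; rewrite in_itv /= => /andP[s1 s2]; apply: h.
  by rewrite !ler0_norm ?lerN2 //; exact: ltW.
- apply: derivable_within_continuous => s; rewrite in_itv /= => /andP[s1 s2].
  by apply: dr; rewrite !ler0_norm ?lerN2 //; exact: ltW.
move=> xi; rewrite in_itv /= => /andP[s1 s2] E.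
exists xi; first by rewrite !ler0_norm ?lerN2 //; exact: ltW.
by rewrite -opprB E sub0r mulrN opprK.
Qed.

Section C1.
Context {R : realType} {n : nat}.
Implicit Types (x y z w : 'rV[R]_n) (A : set 'rV[R]_n) (f g : 'rV[R]_n -> R)
  (p q : 'I_n -> 'rV[R]_n -> R).

Definition cont_at f y := f z @[z --> y] --> f y.

Lemma cvg_rVP f (l : R) y : f z @[z --> y] --> l <->
  forall e : R, 0 < e -> \forall z \near y, `|l - f z| <= e.
Proof. exact: (@cvgrPdist_le _ _ _ (nbhs y) _). Qed.

Lemma cont_cst (c : R) y : cont_at (fun=> c) y.
Proof. exact: (@cvg_cst _ c _ (nbhs y) _). Qed.

Lemma contD f g y : cont_at f y -> cont_at g y -> cont_at (fun z => f z + g z) y.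
Proof. exact: (@cvgD _ _ _ (nbhs y) _ f g). Qed.

Lemma contM f g y : cont_at f y -> cont_at g y -> cont_at (fun z => f z * g z) y.
Proof. exact: (@cvgM _ _ (nbhs y) _ f g). Qed.

Lemma contN f y : cont_at f y -> cont_at (fun z => - f z) y.
Proof. exact: (@cvgN _ _ _ (nbhs y) _ f). Qed.

Lemma contV f y : f y != 0 -> cont_at f y -> cont_at (fun z => (f z)^-1) y.
Proof. exact: (@cvgV _ _ (nbhs y) _ f). Qed.

Lemma cont_sum (I : Type) (r : seq I) (f : I -> 'rV[R]_n -> R) y :
  (forall k, cont_at (f k) y) -> cont_at (fun z => \sum_(k <- r) f k z) y.
Proof. exact: (@cvg_sumr _ _ _ (nbhs y) _ r f). Qed.

Lemma cont_coord k y : cont_at (fun z => z 0 k) y.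
Proof. exact: coord_cont. Qed.

(** Carrying the partial derivatives [p] as data lets the rules below produce
    explicit gradients, to be matched afterwards with convenient formulas. *)
Definition C1on A f p := forall y, A y -> cont_at f y /\
  forall i, is_derive y (basis_vec i) f (p i y) /\ cont_at (p i) y.

Lemma C1on_ext A f g p q : C1on A f p -> f =1 g ->
  (forall i, p i =1 q i) -> C1on A g q.
Proof.
move=> h /funext <- e; have -> // : q = p.
by apply/funext => i; apply/funext => y; rewrite e.
Qed.

Lemma C1on_cst A (c : R) : C1on A (fun=> c) (fun _ _ => 0).
Proof.
move=> y _; split; first exact: cont_cst.
by move=> i; split; [exact: is_derive_cst|exact: cont_cst].
Qed.

Lemma C1on_coord A k : C1on A (fun z => z 0 k) (fun i _ => (k == i)%:R).
Proof.
move=> y _; split; first exact: coord_cont.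
move=> i; split; last exact: cont_cst.
by have := is_derive_coord y (basis_vec i) k; rewrite mxE eqxx.
Qed.

Lemma C1onD A f g p q : C1on A f p -> C1on A g q ->
  C1on A (fun y => f y + g y) (fun i y => p i y + q i y).
Proof.
move=> F G y Ay; have [cf Fi] := F y Ay; have [cg Gi] := G y Ay.
split; first exact: contD.
move=> i; have [F1 F2] := Fi i; have [G1 G2] := Gi i.
by split; [exact: is_deriveD|exact: contD].
Qed.

Lemma C1onM A f g p q : C1on A f p -> C1on A g q ->
  C1on A (fun y => f y * g y) (fun i y => p i y * g y + f y * q i y).
Proof.
move=> F G y Ay; have [cf Fi] := F y Ay; have [cg Gi] := G y Ay.
split; first exact: contM.
move=> i; have [F1 F2] := Fi i; have [G1 G2] := Gi i.
split; last by apply: contD; exact: contM.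
have H := @is_deriveM _ _ f g y (basis_vec i) (p i y) (q i y) F1 G1.
apply: (@is_derive_eq _ _ _ _ _ _ _ _ H).
by rewrite addrC; congr (_ + _); exact: mulrC.
Qed.

Lemma C1on_sum A (I : Type) (r : seq I) (f : I -> 'rV[R]_n -> R) (p : I -> 'I_n -> 'rV[R]_n -> R) :
  (forall k, C1on A (f k) (p k)) ->
  C1on A (fun y => \sum_(k <- r) f k y) (fun i y => \sum_(k <- r) p k i y).
Proof.
move=> H; elim: r => [|k r IH].
  refine (C1on_ext (C1on_cst (A:=A) 0) _ _) => [y|i y]; by rewrite big_nil.
refine (C1on_ext (C1onD (H k) IH) _ _) => [y|i y]; by rewrite big_cons.
Qed.

Lemma C1onV A f p : C1on A f p -> (forall y, A y -> f y != 0) ->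
  C1on A (fun y => (f y)^-1) (fun i y => - p i y * ((f y)^-1 * (f y)^-1)).
Proof.
move=> F nz y Ay; have [cf Fi] := F y Ay; have fy := nz y Ay.
have cV := contV fy cf.
split => // i; have [F1 F2] := Fi i; split; last first.
  by apply: contM; [exact: contN|exact: contM].
case: F1 => F11 F12; apply: DeriveDef; first exact: derivableV.
rewrite deriveV // F12 /GRing.scale /= expr2 invfM !mulNr mulrC //.
Qed.

(** Go from [y] to [z] changing one coordinate at a time, and let [q k] be the
    difference quotient of the [k]-th step.  The mean value theorem places it at
    a value of [p k] taken near [y].  This exact form of differentiability makes
    the chain rule along a curve a limit of products. *)
Lemma caratheodory A f p y : open A -> C1on A f p -> A y ->
  exists q : 'I_n -> 'rV[R]_n -> R,
    (forall k, q k z @[z --> y] --> p k y) /\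
    (forall z, f z - f y = \sum_k q k z * (z 0 k - y 0 k)).
Proof.
move=> oA F Ay.
pose st z (k : nat) : 'rV[R]_n := \row_j (if (j < k)%N then z 0 j else y 0 j).
pose q k z := if z 0 k == y 0 k then p k y
  else (f (st z k.+1) - f (st z k)) / (z 0 k - y 0 k).
have stS z (k : 'I_n) : st z k.+1 = st z k + (z 0 k - y 0 k) *: basis_vec k.
  apply/rowP => j; rewrite !mxE eqxx /= ltnS leq_eqVlt.
  have [->|nk] := eqVneq j k; first by rewrite eqxx ltnn mulr1 addrC subrK.
  by rewrite -(inj_eq val_inj) in nk; rewrite (negbTE nk) mulr0 addr0.
exists q; split; last first.
  move=> z.
  have e0 : y = st z 0%N by apply/rowP => j; rewrite mxE ltn0.
  have en : z = st z n by apply/rowP => j; rewrite mxE ltn_ord.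
  rewrite {1}en {1}e0 -(@telescope_sumr _ 0 n (fun k => f (st z k))) // big_mkord.
  apply: eq_bigr => k _; rewrite /q; case: eqP => [e|/eqP ne].
    by rewrite stS e !subrr scale0r addr0 subrr mulr0.
  by rewrite divfK // subr_eq0.
move=> k; apply/cvg_rVP => e e0.
have [_ /(_ k) [_ ck]] := F y Ay.
have /nbhs_ballP [d /= d0 dP] : nbhs y (A `&` [set z | `|p k y - p k z| <= e]).
  apply: filterI; first exact: open_nbhs_nbhs.
  by move/cvg_rVP : ck; apply.
apply/nbhs_ballP; exists d => //= z yz.
rewrite /q; case: eqP => [_|/eqP ne]; first by rewrite subrr normr0 ltW.
have zy j : `|y 0 j - z 0 j| < d by have [_ /(_ 0 j)] := yz.
have inA s : `|s| <= `|z 0 k - y 0 k| -> ball y d (st z k + s *: basis_vec k).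
  move=> hs; split => // i j; rewrite ord1 !mxE eqxx /= /ball /= .
  have [jk|jk] := eqVneq j k.
    rewrite jk ltnn mulr1 opprD addrA subrr sub0r normrN.
    by apply: le_lt_trans hs _; rewrite distrC.
  rewrite mulr0 addr0; case: ifP => _; first exact: zy.
  by rewrite subrr normr0.
have [|xi hxi E] := @mvt_abs R (fun s => f (st z k + s *: basis_vec k))
    (fun s => p k (st z k + s *: basis_vec k)) (z 0 k - y 0 k).
  move=> s hs; apply: is_derive_line.
  by have [As _] := dP _ (inA s hs); have [_ /(_ k) []] := F _ As.
rewrite -stS scale0r addr0 in E.
rewrite E mulfK ?subr_eq0 //.
by have [] := dP _ (inA xi hxi).
Qed.

Lemma C1on_curve A f p y (gam : R -> 'rV[R]_n) (c : 'I_n -> R) :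
  open A -> C1on A f p -> A y -> gam 0 = y ->
  (forall k, is_derive (0:R) 1 (fun t => gam t 0 k) (c k)) ->
  is_derive (0:R) 1 (f \o gam) (\sum_k p k y * c k).
Proof.
move=> oA F Ay g0 dg.
have [q [cq eq]] := caratheodory oA F Ay.
have cg : gam t @[t --> 0] --> y.
  apply/cvgrPdist_le => e e0; near=> t.
  rewrite /Num.Def.normr/= mx_normrE (bigmax_le _ (ltW e0))//= => -[i j] _ /=.
  rewrite ord1 !mxE; move: j; near: t; apply: filter_forall => j /=.
  have /derivable1_diffP/differentiable_continuous : derivable (fun t => gam t 0 j) 0 1.
    by have [] := dg j.
  by move=> /cvgrPdist_le /(_ _ e0); rewrite g0.
have lim : h^-1 *: ((f \o gam) (h *: (1:R) + 0) - (f \o gam) 0) @[h --> 0^'] --> \sum_k p k y * c k.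
  have -> : (fun h : R => h^-1 *: ((f \o gam) (h *: (1:R) + 0) - (f \o gam) 0)) =
      (fun h => \sum_k q k (gam h) * (h^-1 *: (gam (h *: (1:R) + 0) 0 k - gam 0 0 k))).
    apply/funext => h; rewrite /= addr0 [h%:A]mulr1 g0 eq scaler_sumr.
    by apply: eq_bigr => k _; rewrite scalerAr.
  have := @cvg_sumr R _ _ ((0:R)^') _ (index_enum 'I_n) (fun k h => q k (gam h) * (h^-1 *: (gam (h *: (1:R) + 0) 0 k - gam 0 0 k))) (fun k => p k y * c k); apply => k.
  apply: cvgM.
    apply: (@cvg_comp _ _ _ gam (q k) _ (nbhs y)); last exact: cq.
    apply: cvg_trans cg; exact: cvg_within_filter.
  by have [/cvg_ex [l dl] E] := dg k; move: E; rewrite /derive (cvg_lim _ dl) // => <-.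
apply: DeriveDef; first by apply/cvg_ex; eexists; exact: lim.
by rewrite /derive; exact: cvg_lim lim.
Unshelve. all: by end_near. Qed.

Lemma C1on_dir A f p y w : open A -> C1on A f p -> A y ->
  is_derive y w f (\sum_k p k y * w 0 k).
Proof.
move=> oA F Ay; apply: is_derive_line0.
apply: (C1on_curve (gam := fun t => y + t *: w) oA F) => //; first by rewrite scale0r addr0.
move=> k; apply: is_derive_line (is_derive_coord _ _ _).
Qed.

End C1.

Section C1comp.
Context {R : realType} {n m : nat}.

Lemma C1on_comp (A : set 'rV[R]_n) (B : set 'rV[R]_m) f p
    (phi : 'rV[R]_n -> 'rV[R]_m) q :
  open B -> C1on B f p -> (forall y, A y -> B (phi y)) ->
  (forall k, C1on A (fun y => phi y 0 k) (q k)) ->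
  C1on A (fun y => f (phi y)) (fun i y => \sum_k p k (phi y) * q k i y).
Proof.
move=> oB F AB Q y Ay; have [cf Fi] := F _ (AB _ Ay).
have cphi : phi z @[z --> y] --> phi y.
  apply/(@cvgrPdist_le _ _ _ (nbhs y) _) => e e0; near=> t.
  rewrite /Num.Def.normr/= mx_normrE (bigmax_le _ (ltW e0))//= => -[i j] _ /=.
  rewrite ord1 !mxE; move: j; near: t; apply: filter_forall => j /=.
  by have [/cvg_rVP/(_ _ e0)] := Q j y Ay.
split; first by apply: (@cvg_comp _ _ _ phi f _ (nbhs (phi y))).
move=> i; split; last first.
  apply: (cont_sum (f := fun k z => p k (phi z) * q k i z)) => k.
  apply: (@contM _ _ (fun z => p k (phi z))); last by have [_ /(_ i) []] := Q k y Ay.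
  by apply: (@cvg_comp _ _ _ phi (p k) _ (nbhs (phi y))); [exact: cphi|have [] := Fi k].
apply: is_derive_line0.
apply: (C1on_curve (gam := fun t => phi (y + t *: basis_vec i)) oB F (AB _ Ay)).
  by rewrite scale0r addr0.
move=> k; apply: (@is_derive_line _ _ (fun z => phi z 0 k)).
by rewrite scale0r addr0; have [_ /(_ i) []] := Q k y Ay.
Unshelve. all: by end_near. Qed.

End C1comp.

(** * A mean value on the cube *)

Lemma free_ultrafilter : exists G : set_system nat, UltraFilter G /\ (\oo : set_system nat) `<=` G.
Proof. exact: ultraFilterLemma. Qed.

Definition free_ultra : set_system nat := sval (cid free_ultrafilter).

Global Instance free_ultraP : UltraFilter free_ultra.
Proof. by have [] := svalP (cid free_ultrafilter). Qed.

Lemma free_ultra_oo : (\oo : set_system nat) `<=` free_ultra.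
Proof. by have [] := svalP (cid free_ultrafilter). Qed.

Section Ulim.
Context {R : realType}.
Implicit Types a b : nat -> R.

Definition bounded_seq a := exists M : R, forall k, `|a k| <= M.

Definition ulim a : R := lim (a @ free_ultra).

(** The image ultrafilter contains a compact interval, hence converges. *)
Lemma ulim_cvg a : bounded_seq a -> a @ free_ultra --> ulim a.
Proof.
move=> [M hM].
have FF : UltraFilter (a @ free_ultra).
  split; first exact: fmap_proper_filter.
  move=> G PG le; apply/seteqP; split => // A GA.
  have [//|nA] := @in_ultra_setVsetC _ _ (a @^-1` A) free_ultraP.
  have := le (~` A) nA => GnA.
  have : G (A `&` ~` A) by exact: filterI.
  by rewrite setICr => /filter_not_empty.
have cpt := @segment_compact R (- M) M; rewrite compact_ultra in cpt.
have /cpt : (a @ free_ultra) `[- M, M]%classic.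
  by apply: nearW => k; have := hM k; rewrite /= in_itv /= ler_norml.
move=> [l [_ al]].
exact: cvgP al.
Qed.

Lemma ulimE a (l : R) : a @ free_ultra --> l -> ulim a = l.
Proof. exact: cvg_lim. Qed.

Lemma ulim_oo a (l : R) : a @ \oo --> l -> ulim a = l.
Proof. by move=> h; apply: ulimE => A /h; exact: free_ultra_oo. Qed.

Lemma ulim_cst (c : R) : ulim (fun=> c) = c.
Proof. by apply: ulimE; exact: cvg_cst. Qed.

Lemma ulimD a b : bounded_seq a -> bounded_seq b ->
  ulim (fun k => a k + b k) = ulim a + ulim b.
Proof. by move=> /ulim_cvg ha /ulim_cvg hb; apply: ulimE; exact: cvgD. Qed.

Lemma ulimZ (c : R) a : bounded_seq a -> ulim (fun k => c * a k) = c * ulim a.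
Proof. by move=> /ulim_cvg ha; apply: ulimE; apply: cvgM => //; exact: cvg_cst. Qed.

Lemma ulim_le a b : bounded_seq a -> bounded_seq b -> (forall k, a k <= b k) ->
  ulim a <= ulim b.
Proof.
move=> /ulim_cvg ha /ulim_cvg hb ab.
by apply: (ler_cvg_to ha hb); exact: nearW.
Qed.

End Ulim.

Section Grid.
Context {R : realType} {n : nat}.
Implicit Types (x y z w : 'rV[R]_n) (f g H : 'rV[R]_n -> R).

Definition grid_pt N (j : {ffun 'I_n -> 'I_N}) : 'rV[R]_n :=
  \row_i (-1 + 2 * (j i)%:R / N%:R).

Definition grid_avg N f : R :=
  (\sum_(j : {ffun 'I_n -> 'I_N}) f (grid_pt j)) / N%:R ^+ n.

(** The factor [4 * n] places the cube [(2n)^-1, n^-1]^n exactly on grid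
    lines, which makes the lower bound for the average of a positive
    function a matter of counting. *)
Definition mesh k := (4 * n * k.+1)%N.

Definition cube := [set x : 'rV[R]_n | forall i, `|x 0 i| <= 1].

Definition cube_mean f : R := ulim (fun k => grid_avg (mesh k) f).

Definition bounded_cube f := exists M : R, forall x, cube x -> `|f x| <= M.

Lemma grid_cube N (j : {ffun 'I_n -> 'I_N}) : cube (grid_pt j).
Proof.
move=> i; rewrite mxE; have := ltn_ord (j i); case: N j => [|N] j; first by case: (j i).
move=> jl; have N0 : (0 : R) < N.+1%:R by rewrite ltr0n.
have h1 : (0 : R) <= (j i)%:R / N.+1%:R by rewrite divr_ge0.
have h2 : (j i)%:R / N.+1%:R <= (1 : R) by rewrite ler_pdivrMr // mul1r ler_nat ltnW.
by rewrite -mulrA ler_norml; move: ((j i)%:R / N.+1%:R) h1 h2 => q h1 h2; apply/andP; split; lra.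
Qed.

Lemma grid_avgD N f g : grid_avg N (fun x => f x + g x) = grid_avg N f + grid_avg N g.
Proof. by rewrite /grid_avg big_split mulrDl. Qed.

Lemma grid_avgZ N (c : R) f : grid_avg N (fun x => c * f x) = c * grid_avg N f.
Proof. by rewrite /grid_avg -mulr_sumr mulrA. Qed.

Lemma grid_avg_le N f g : (forall x, cube x -> f x <= g x) ->
  grid_avg N f <= grid_avg N g.
Proof.
move=> h; apply: ler_wpM2r; first by rewrite invr_ge0 exprn_ge0.
by apply: ler_sum => j _; apply: h; exact: grid_cube.
Qed.

Lemma grid_avg1 k : (0 < n)%N -> grid_avg (mesh k) (fun=> 1) = 1.
Proof.
move=> n0; rewrite /grid_avg sumr_const card_ffun !card_ord -natrX divff //.
by rewrite pnatr_eq0 -lt0n expn_gt0 /mesh !muln_gt0 n0.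
Qed.

Lemma grid_avg_bound f (M : R) k : (0 < n)%N -> (forall x, cube x -> `|f x| <= M) ->
  `|grid_avg (mesh k) f| <= M.
Proof.
move=> n0 h; rewrite -[M]mulr1 -(grid_avg1 k n0) -grid_avgZ ler_norml -mulN1r.
rewrite -grid_avgZ; apply/andP; split; apply: grid_avg_le => x /h.
  by rewrite ler_norml => /andP[]; lra.
by rewrite ler_norml => /andP[]; lra.
Qed.

Lemma grid_avg_bounded f : (0 < n)%N -> bounded_cube f ->
  bounded_seq (fun k => grid_avg (mesh k) f).
Proof. by move=> n0 [M hM]; exists M => k; exact: grid_avg_bound. Qed.

Lemma mesh_gt0 k : (0 < n)%N -> (0 < mesh k)%N.
Proof. by move=> n0; rewrite /mesh !muln_gt0 n0. Qed.

(** Functions supported in the unit ball do not see the boundary of the cube,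
    so the grid may be treated as periodic. *)
Lemma grid_shift N f i : (0 < N)%N -> (forall x, 1 <= dot x x -> f x = 0) ->
  grid_avg N (fun x => f (x + (2 / N%:R) *: basis_vec i)) = grid_avg N f.
Proof.
move=> N0 f0; rewrite /grid_avg; congr (_ / _).
pose S (g : 'I_N -> 'I_N) (j : {ffun 'I_n -> 'I_N}) : {ffun 'I_n -> 'I_N} :=
  [ffun k => if k == i then g (j i) else j k].
have SK (g h : 'I_N -> 'I_N) : cancel g h -> cancel (S g) (S h).
  move=> gh j; apply/ffunP => k; rewrite !ffunE eqxx.
  by case: eqP => [->|//]; rewrite gh.
rewrite [RHS](reindex (S (@ordS N))) /=; last first.
  exists (S (@ord_pred N)) => j _; apply: SK; [exact: ordSK|exact: ord_predK].
apply: eq_bigr => j _.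
have N0' : (N%:R : R) != 0 by rewrite pnatr_eq0 -lt0n.
have edge x : `|x 0 i| = 1 -> f x = 0.
  move=> x1; apply: f0; apply: le_trans (coord_sqr_le x i).
  by rewrite -real_normK ?num_real // x1 expr1n.
have := ltn_ord (j i); rewrite leq_eqVlt => /predU1P [e|lt].
  rewrite !edge //.
    by rewrite mxE ffunE eqxx /= e modnn mulr0 mul0r addr0 normrN normr1.
  have eN : (N%:R : R) = (j i)%:R + 1 by rewrite natr1 e.
  rewrite !mxE !eqxx mulr1 (_ : _ + _ = 1) ?normr1 //.
  by rewrite eN; field; rewrite natr1 pnatr_eq0.
congr f; apply/rowP => k; rewrite !mxE ffunE eqxx /=.
have [->|nk] := eqVneq k i; last by rewrite mulr0 addr0.
by rewrite /= modn_small // -natr1; field.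
Qed.

Lemma cube_compact : compact cube.
Proof.
have -> : cube = [set x | forall i, `[(-1 : R), 1]%classic (x ord0 i)].
  by apply/seteqP; split => x h i; have := h i; rewrite /= in_itv /= ler_norml.
by apply: (@rV_compact _ _ (fun=> `[(-1:R), 1]%classic)) => i; exact: segment_compact.
Qed.

(** The grid average of the difference quotient of [f] with the grid step
    vanishes, and difference quotients converge to [df] uniformly on the
    cube. *)
Lemma cube_mean_partial f (df : 'rV[R]_n -> R) i : (0 < n)%N ->
  (forall x, is_derive x (basis_vec i) f (df x)) -> (forall x, cont_at df x) ->
  (forall x, 1 <= dot x x -> f x = 0) -> cube_mean df = 0.
Proof.
move=> n0 dfP cdf f0; apply: ulim_oo; apply/cvgrPdist_le => e e0.
have unif : \forall t \near (0 : R), cube `<=` (fun x => `|df (x + t *: basis_vec i) - df x| <= e).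
  have cc := cube_compact; rewrite compact_near_coveringP in cc.
  have := cc R (nbhs (0:R)) (fun t x => `|df (x + t *: basis_vec i) - df x| <= e) _; apply => x _.
  have cs : (p.1 + p.2 *: basis_vec i) @[p --> (x, (0:R))] --> x + (0:R) *: basis_vec i.
    apply: (@cvgD _ _ _ (filter_prod (nbhs x) (nbhs (0:R))) _ fst (fun p => p.2 *: basis_vec i)); first exact: cvg_fst.
    by apply: (@cvgZr_tmp _ _ _ (filter_prod (nbhs x) (nbhs (0:R))) _ snd); exact: cvg_snd.
  rewrite scale0r addr0 in cs.
  have e20 : 0 < e / 2 by rewrite divr_gt0.
  have /cvg_rVP/(_ _ e20) h := cdf x.
  have h1 : \forall p \near (x, (0:R)), `|df x - df (p.1 + p.2 *: basis_vec i)| <= e / 2 by exact: cs _ h.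
  have h2 : \forall p \near (x, (0:R)), `|df x - df p.1| <= e / 2.
    by have := @cvg_fst _ _ (nbhs x) (nbhs (0:R)) _ _ h; apply.
  apply: (@filterS _ (filter_prod (nbhs x) (nbhs (0:R))) _ _ _ _ (filterI h1 h2)) => -[x' t] /= [a1 a2].
  rewrite -[X in X - _](subrK (df x)) -addrA (splitr e).
  by apply: le_trans (ler_normD _ _) _; rewrite lerD // distrC.
have [d /= d0 dP] := unif.
have lim : (2 / (mesh k)%:R : R) @[k --> \oo] --> (0:R).
  have -> : (fun k => 2 / (mesh k)%:R : R) = (fun k => (2 * (4 * n)%:R^-1) * (k.+1%:R^-1)).
    by apply/funext => k; rewrite /mesh natrM invfM mulrA.
  by rewrite -[X in _ --> X](mulr0 (2 * (4 * n)%:R^-1)); apply: cvgM; [exact: cvg_cst|exact: cvg_harmonic].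
move/cvgrPdist_lt : lim => /(_ _ d0); apply: filterS => k; rewrite sub0r normrN.
set h := 2 / _ => hd; rewrite sub0r normrN.
have h0 : 0 < h by rewrite /h divr_gt0 // ltr0n mesh_gt0.
have -> : grid_avg (mesh k) df =
    grid_avg (mesh k) (fun x => df x + (- h^-1) * (f (x + h *: basis_vec i) + (-1) * f x)).
  rewrite grid_avgD grid_avgZ grid_avgD grid_avgZ grid_shift ?mesh_gt0 //.
  by rewrite mulN1r subrr mulr0 addr0.
apply: grid_avg_bound => // x cx.
have [|xi xih] := @mvt_abs R (fun s => f (x + s *: basis_vec i)) (fun s => df (x + s *: basis_vec i)) h.
  by move=> s _; apply: is_derive_line; exact: dfP.
rewrite scale0r addr0 mulN1r => ->.
rewrite mulNr mulrCA mulVf ?gt_eqF // mulr1 distrC.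
apply: dP => //=.
by rewrite sub0r normrN; exact: le_lt_trans xih hd.
Qed.

End Grid.

Section CubeMean.
Context {R : realType} {n : nat}.
Hypothesis n0 : (0 < n)%N.
Implicit Types (x y z w : 'rV[R]_n) (f g H : 'rV[R]_n -> R).

Lemma cube_meanD f g : bounded_cube f -> bounded_cube g ->
  cube_mean (fun x => f x + g x) = cube_mean f + cube_mean g.
Proof.
move=> bf bg; rewrite /cube_mean -ulimD; try exact: grid_avg_bounded.
by congr ulim; apply/funext => k; exact: grid_avgD.
Qed.

Lemma cube_meanZ (c : R) f : bounded_cube f ->
  cube_mean (fun x => c * f x) = c * cube_mean f.
Proof.
move=> bf; rewrite /cube_mean -ulimZ; last exact: grid_avg_bounded.
by congr ulim; apply/funext => k; exact: grid_avgZ.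
Qed.

Lemma cube_mean_le f g : bounded_cube f -> bounded_cube g ->
  (forall x, cube x -> f x <= g x) -> cube_mean f <= cube_mean g.
Proof.
move=> bf bg fg; apply: ulim_le; try exact: grid_avg_bounded.
by move=> k; exact: grid_avg_le.
Qed.

Lemma cube_mean_cst (c : R) : cube_mean (fun _ : 'rV[R]_n => c) = c.
Proof.
rewrite /cube_mean -[RHS]ulim_cst; congr ulim; apply/funext => k.
by rewrite -[RHS]mulr1 -(@grid_avg1 R n k n0) -grid_avgZ; congr grid_avg; apply/funext => x; rewrite mulr1.
Qed.

(** The grid of [mesh k] has at least [(k + 1)^n] points in the small cube, the
    fraction [(4 n)^-n] of all its points. *)
Lemma cube_mean_gt0 f (c : R) : bounded_cube f -> (forall x, cube x -> 0 <= f x) -> 0 < c ->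
  (forall x, (forall i, (2 * n%:R)^-1 <= x 0 i <= n%:R^-1) -> c <= f x) ->
  0 < cube_mean f.
Proof.
move=> bf f0 c0 fc.
have nR : (0 : R) < n%:R by rewrite ltr0n.
apply: (@lt_le_trans _ _ (c * ((4 * n)%:R ^- n))).
  by rewrite mulr_gt0 // invr_gt0 exprn_gt0 // ltr0n muln_gt0.
rewrite -[X in X <= _](@ulim_cst R).
apply: ulim_le; first by exists `|c * (4 * n)%:R ^- n| => k.
  exact: grid_avg_bounded.
move=> k.
set K := k.+1; set N := mesh k.
have NE : N = (4 * n * K)%N by [].
(* in each coordinate, the indices of the grid points in the small cube *)
pose B := [pred a : 'I_N | ((2 * n + 1) * K <= a < (2 * n + 2) * K)%N].
have BK : (K <= #|B|)%N.
  have lt (a : 'I_K) : ((2 * n + 1) * K + a < N)%N.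
    rewrite NE; apply: (@leq_trans ((2 * n + 1) * K + K)); first by rewrite ltn_add2l.
    by rewrite -mulSnr leq_mul2r; apply/orP; right; lia.
  pose g (a : 'I_K) : 'I_N := Ordinal (lt a).
  have gi : injective g by move=> a b /(congr1 val) /= /addnI /val_inj.
  rewrite -[X in (X <= _)%N](card_ord K) -(card_codom gi); apply: subset_leq_card.
  apply/fintype.subsetP => b /codomP [a ->]; rewrite inE /= leq_addr /=.
  by have := ltn_ord a; lia.
have sum_ge : c * K%:R ^+ n <= \sum_(j : {ffun 'I_n -> 'I_N}) f (grid_pt j).
  apply: (@le_trans _ _ (\sum_(j : {ffun 'I_n -> 'I_N} | j \in ffun_on B) c)).
    rewrite sumr_const card_ffun_on card_ord -[c *+ _]mulr_natr natrX.
    apply: ler_wpM2l; first exact: ltW.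
    by rewrite lerXn2r ?nnegrE // ler_nat.
  rewrite big_mkcond; apply: ler_sum => j _; case: ifP => [/ffun_onP jB|_].
    apply: fc => i; have := jB i; rewrite inE /= => /andP [h1 h2].
    have NR : (N%:R : R) = 4 * n%:R * K%:R by rewrite NE !natrM.
    rewrite mxE NR.
    have KR : (0 : R) < K%:R by rewrite ltr0n.
    have h1' : (2 * n%:R + 1) * K%:R <= (j i)%:R :> R by rewrite -(ler_nat R) natrM natrD natrM in h1.
    have h2' : (j i)%:R <= (2 * n%:R + 2) * K%:R :> R by move/ltnW : h2; rewrite -(ler_nat R) natrM natrD natrM.
    have -> : -1 + 2 * (j i)%:R / (4 * n%:R * K%:R) = ((j i)%:R - 2 * n%:R * K%:R) / (2 * n%:R * K%:R) :> R.
      by field; rewrite !gt_eqF.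
    rewrite ler_pdivlMr ?mulr_gt0 // ler_pdivrMr ?mulr_gt0 //.
    have -> : (2 * n%:R)^-1 * (2 * n%:R * K%:R) = K%:R :> R by field; rewrite gt_eqF.
    have -> : n%:R^-1 * (2 * n%:R * K%:R) = 2 * K%:R :> R by field; rewrite gt_eqF.
    by apply/andP; split; nra.
  by apply: f0; exact: grid_cube.
rewrite /grid_avg -/N ler_pdivlMr ?exprn_gt0 ?ltr0n ?mesh_gt0 //.
have NX : (N%:R : R) = (4 * n)%:R * K%:R by rewrite NE natrM.
apply: le_trans sum_ge; rewrite NX exprMn mulrA divfK //.
by rewrite expf_neq0 // pnatr_eq0 -lt0n muln_gt0.
Qed.

End CubeMean.

Section PositivePart.
Context {R : realType}.

(** The corner of the positive part is harmless where [q] is flat. *)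
Lemma is_derive_pospart (q dq : R -> R) (x : R) :
  (forall t : R, 0 <= t -> is_derive t 1 q (dq t)) -> dq 0 = 0 ->
  is_derive x 1 (fun t => q (Num.max 0 t)) (dq (Num.max 0 x)).
Proof.
move=> h d0; have [x0|x0|<-] := ltgtP 0 x.
- have := h x (ltW x0); apply: near_eq_is_derive.
  near=> t; rewrite max_r //; apply: ltW.
  by near: t; exact: lt_nbhsr.
- rewrite d0; have := @is_derive_cst R _ _ (q 0) x 1; apply: near_eq_is_derive.
  near=> t; rewrite max_l //; apply: ltW.
  by near: t; exact: lt_nbhsl.
rewrite d0.
have lim : t^-1 *: (q (Num.max 0 (t *: (1:R) + 0)) - q (Num.max 0 0)) @[t --> 0^'] --> (0:R).
  apply/cvgrPdist_le => e e0.
  have [/cvg_ex [l dl] E] := h 0 (lexx _).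
  move: E; rewrite /derive (cvg_lim _ dl) // d0 => l0; subst l.
  move/cvgrPdist_le : dl => /(_ _ e0); rewrite !near_withinE.
  apply: filterS => t ht t0; have := ht t0.
  rewrite /= !sub0r !normrN maxxx !addr0 [t%:A]mulr1.
  by case: (leP 0 t) => // _ _; rewrite subrr scaler0 normr0 ltW.
apply: DeriveDef; first by apply/cvg_ex; eexists; exact: lim.
by rewrite /derive; exact: cvg_lim lim.
Unshelve. all: by end_near. Qed.

Definition pos1 (s : R) := Num.max 0 (1 - s).

Lemma pos1_cont : continuous pos1.
Proof.
move=> s; have h := @continuous_max R R (fun=> 0) (fun s => 1 - s) s; apply: h.
  exact: cvg_cst.
by apply: cvgB; [exact: cvg_cst|exact: cvg_id].
Qed.

Lemma is_derive_pos1X (s : R) l :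
  is_derive s 1 (fun t => pos1 t ^+ l.+2) (- (l.+2%:R * pos1 s ^+ l.+1)).
Proof.
have H (t : R) : is_derive t 1 (fun u : R => u ^+ l.+2) (l.+2%:R * t ^+ l.+1).
  apply: DeriveDef; first exact: exprn_derivable.
  by rewrite exp_derive /GRing.scale /= mulr1.
have P := @is_derive_pospart (fun u => u ^+ l.+2) _ (1 - s) (fun t _ => H t).
have D : is_derive s 1 (fun u : R => 1 - u) (-1).
  have E := @is_deriveB R R R (cst 1) id s 1 0 1 (is_derive_cst _ _ _) (is_derive_id _ _).
  apply: (@is_derive_eq _ _ _ _ _ _ _ _ E); exact: sub0r.
have := @is_derive1_comp R (fun u => Num.max 0 u ^+ l.+2) (fun u => 1 - u) s _ (-1) (P _) D.
by rewrite mulrN1; apply; rewrite expr0n mulr0.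
Qed.
End PositivePart.

(** * The divergence theorem on the unit ball *)

Section Composition.
Context {R : realType} {n : nat}.
Implicit Types (x y z w : 'rV[R]_n) (A : set 'rV[R]_n) (f g : 'rV[R]_n -> R).

Lemma cont_comp1 f (G : R -> R) y : cont_at f y -> {for f y, continuous G} ->
  cont_at (fun z => G (f z)) y.
Proof. by move=> cf cG; apply: (@cvg_comp _ _ _ f G (nbhs y) (nbhs (f y))). Qed.

Lemma C1on_comp1 A f p (G dG : R -> R) : C1on A f p ->
  (forall s : R, is_derive s 1 G (dG s)) -> continuous dG ->
  C1on A (fun y => G (f y)) (fun i y => dG (f y) * p i y).
Proof.
move=> F dGP cdG y Ay; have [cf Fi] := F y Ay.
split.
  apply: cont_comp1 => //; apply/differentiable_continuous/derivable1_diffP.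
  by have [] := dGP (f y).
move=> i; have [F1 F2] := Fi i; split; last first.
  by apply: contM => //; apply: cont_comp1 => //; exact: cdG.
apply: is_derive_line0.
have L : is_derive (0:R) 1 (fun t => f (y + t *: basis_vec i)) (p i y).
  by apply: is_derive_line; rewrite scale0r addr0.
have G0 := dGP (f y).
have := @is_derive1_comp R G (fun t => f (y + t *: basis_vec i)) 0 (dG (f y)) (p i y).
by rewrite scale0r addr0; apply.
Qed.

Lemma C1on_nsq A : C1on A (fun y => dot y y) (fun i y => 2 * y 0 i).
Proof.
refine (C1on_ext (@C1on_sum _ _ A _ (index_enum 'I_n) _ _ (fun k => C1onM (C1on_coord (A:=A) k) (C1on_coord (A:=A) k))) _ _) => [//|i y].
rewrite (bigD1 i) //= eqxx big1 ?addr0; first by rewrite mul1r mulr1 mulr_natl.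
by move=> j /negbTE ->; rewrite mul0r mulr0 addr0.
Qed.

Lemma C1on_dot A w : C1on A (fun y => dot y w) (fun i _ => w 0 i).
Proof.
refine (C1on_ext (@C1on_sum _ _ A _ (index_enum 'I_n) _ _ (fun k => C1onM (C1on_coord (A:=A) k) (C1on_cst (A:=A) (w 0 k)))) _ _) => [//|i y].
rewrite (bigD1 i) //= eqxx big1 ?addr0; first by rewrite mul1r mulr0 addr0.
by move=> j /negbTE ->; rewrite mul0r mulr0 addr0.
Qed.

Lemma cont_bounded K f : compact K -> (forall x, K x -> cont_at f x) ->
  exists M : R, forall x, K x -> `|f x| <= M.
Proof.
move=> cK cf.
have cfw : {within K, continuous f}.
  by apply: continuous_in_subspaceT => x; rewrite inE; exact: cf.
have := compact_bounded (continuous_compact cfw cK).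
move=> [M [_ hM]]; exists (M + 1) => x Kx; apply: hM; first by rewrite ltrDl.
by exists x.
Qed.

Lemma cont_near_eq f g y : (\forall z \near y, f z = g z) -> cont_at f y -> cont_at g y.
Proof.
move=> e /cvg_rVP cf; apply/cvg_rVP => d d0; have ey := nbhs_singleton e.
have h := @filterI _ _ (nbhs_filter y) _ _ e (cf _ d0).
by apply: (@filterS _ _ (nbhs_filter y) _ _ _ h) => z [<-]; rewrite /= -ey.
Qed.

Section Div.
Hypothesis n0 : (0 < n)%N.
Variables (psi dpsi : R -> R) (rho : R).
Hypothesis rho1 : 1 < rho.
Hypothesis dpsiP : forall s : R, is_derive s 1 psi (dpsi s).
Hypothesis cdpsi : continuous dpsi.
Hypothesis psi0 : forall s, 1 <= s -> psi s = 0 /\ dpsi s = 0.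

(** This is the mean of the divergence of the field [F] multiplied by the
    weight [psi (|x|^2)], which vanishes outside the unit ball. *)
Lemma cube_mean_div (F D : 'I_n -> 'rV[R]_n -> R) :
  (forall i y, ballr rho y -> cont_at (F i) y /\
     is_derive y (basis_vec i) (F i) (D i y) /\ cont_at (D i) y) ->
  cube_mean (fun x => \sum_i (D i x * psi (dot x x) +
                              F i x * (dpsi (dot x x) * (2 * x 0 i)))) = 0.
Proof.
move=> FD.
pose dH i x := D i x * psi (dot x x) + F i x * (dpsi (dot x x) * (2 * x 0 i)).
have C := C1on_comp1 (C1on_nsq (A := setT)) dpsiP cdpsi.
have far x : ~ ballr rho x -> \forall z \near x, 1 <= dot z z.
  move=> /negP; rewrite -leNgt => hx.
  have : open [set y : 'rV[R]_n | 1 < dot y y].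
    apply: (@open_comp _ _ (fun x => dot x x) [set t | 1 < t]); last exact: open_gt.
    by move=> *; exact: dotxx_cont.
  move=> o; have : nbhs x [set y : 'rV[R]_n | 1 < dot y y].
    by apply: open_nbhs_nbhs; split => //=; exact: lt_le_trans rho1 hx.
  by apply: filterS => z /ltW.
have dHc i x : cont_at (dH i) x.
  have [Ax|/far nx] := pselect (ballr rho x).
    have [cF [_ cD]] := FD i x Ax; have [cp Cp] := C x I; have [_ cdp] := Cp i.
    by apply: contD; apply: contM.
  apply: (@cont_near_eq (fun=> 0)); last exact: cont_cst.
  by apply: filterS nx => z hz; rewrite /dH; have [-> ->] := psi0 hz; rewrite mul0r !mulr0 addr0.
have dH0 i : cube_mean (dH i) = 0.
  apply: (@cube_mean_partial _ _ (fun x => F i x * psi (dot x x)) _ i) => //.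
    move=> x; have [Ax|/far nx] := pselect (ballr rho x).
      have [_ [dF _]] := FD i x Ax; have [_ /(_ i) [dp _]] := C x I.
      have H := @is_deriveM _ _ (F i) (fun x => psi (dot x x)) x (basis_vec i) _ _ dF dp.
      apply: (@is_derive_eq _ _ _ _ _ _ _ _ H).
      by rewrite /dH addrC; congr (_ + _); exact: mulrC.
    have -> : dH i x = 0.
      have := nbhs_singleton nx => hx.
      by rewrite /dH; have [-> ->] := psi0 hx; rewrite mul0r !mulr0 addr0.
    apply: (@near_eq_is_derive _ _ _ (fun=> 0)).
    by apply: filterS nx => z hz; have [-> _] := psi0 hz; rewrite mulr0.
  by move=> x hx; have [-> _] := psi0 hx; rewrite mulr0.
have bdH i : bounded_cube (dH i) by apply: cont_bounded; [exact: cube_compact|move=> x _; exact: dHc].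
have [-> //] : cube_mean (fun x => \sum_i dH i x) = 0 /\ bounded_cube (fun x => \sum_i dH i x).
elim: (index_enum 'I_n) => [|i r [IH1 IH2]].
  rewrite (_ : (fun x => _) = (fun=> 0)); last by apply/funext => x; rewrite big_nil.
  by split; [rewrite cube_mean_cst|exists 0 => x _; rewrite normr0].
rewrite (_ : (fun x => _) = (fun x => dH i x + \sum_(j <- r) dH j x)); last by apply/funext => x; rewrite big_cons.
split; first by rewrite cube_meanD // dH0 IH1 addr0.
have [M hM] := bdH i; have [M' hM'] := IH2; exists (M + M') => x cx.
by apply: le_trans (ler_normD _ _) _; rewrite lerD ?hM ?hM'.
Qed.

End Div.
End Composition.

(** * The mean value on the unit sphere *)

Section Weights.
Context {R : realType}.

(** As functions of [s = |x|^2], these weights live on the unit ball; for [l]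
    fixed and [k] large they concentrate at [s = 1]. *)
Definition psi k l (s : R) := s ^+ k * pos1 s ^+ l.
Definition dpsi k l (s : R) :=
  (k%:R * s ^+ k.-1) * pos1 s ^+ l + s ^+ k * - (l%:R * pos1 s ^+ l.-1).

Lemma pos1_ge0 (s : R) : 0 <= pos1 s.
Proof. by rewrite /pos1 le_max lexx. Qed.

Lemma pos1_le (s : R) : s <= 1 -> pos1 s = 1 - s.
Proof. by move=> h; rewrite /pos1 max_r // subr_ge0. Qed.

Lemma pos1_far (s : R) : 1 <= s -> pos1 s = 0.
Proof. by move=> h; rewrite /pos1 max_l // subr_le0. Qed.

Lemma psi_ge0 k l (s : R) : 0 <= s -> 0 <= psi k l s.
Proof. by move=> h; rewrite mulr_ge0 // exprn_ge0 // pos1_ge0. Qed.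

Lemma psi_far k l (s : R) : 1 <= s -> psi k l.+1 s = 0.
Proof. by move=> h; rewrite /psi pos1_far // expr0n mulr0. Qed.

Lemma psi_le1 k l (s : R) : 0 <= s <= 1 -> psi k l s <= 1.
Proof.
move=> /andP [s0 s1]; rewrite /psi -[X in _ <= X]mulr1.
apply: ler_pM; rewrite ?exprn_ge0 ?pos1_ge0 ?exprn_ile1 ?pos1_ge0 //.
by rewrite pos1_le //; lra.
Qed.

Lemma is_derive_psi k l (s : R) : is_derive s 1 (psi k l.+2) (dpsi k l.+2 s).
Proof.
have D1 : is_derive s 1 (fun t : R => t ^+ k) (k%:R * s ^+ k.-1).
  apply: DeriveDef; first exact: exprn_derivable.
  by rewrite exp_derive /GRing.scale /= mulr1.
have D2 := is_derive_pos1X s l.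
have H := @is_deriveM _ _ (fun t : R => t ^+ k) (fun t => pos1 t ^+ l.+2) s 1 _ _ D1 D2.
apply: (@is_derive_eq _ _ _ _ _ _ _ _ H).
by rewrite /dpsi addrC; congr (_ + _); exact: mulrC.
Qed.

Lemma dpsi_far k l (s : R) : 1 <= s -> dpsi k l.+2 s = 0.
Proof. by move=> h; rewrite /dpsi pos1_far // !expr0n /= !mulr0 oppr0 mulr0 addr0. Qed.

Lemma dpsi_cont k l : continuous (dpsi k l.+2).
Proof.
have cX j : continuous (fun s : R => s ^+ j) by exact: exprn_continuous.
have cP j : continuous (fun s : R => pos1 s ^+ j).
  by move=> s; apply: (@continuous_comp _ _ _ (@pos1 R) (fun u => u ^+ j)); [exact: pos1_cont|exact: cX].
move=> s; apply: cvgD; apply: cvgM; try exact: cX; try exact: cP.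
  by apply: cvgM; [exact: cvg_cst|exact: cX].
by apply: cvgN; apply: cvgM; [exact: cvg_cst|exact: cP].
Qed.

Lemma dpsiE k l (s : R) :
  s * dpsi k l.+1 s = k%:R * psi k l.+1 s - l.+1%:R * psi k.+1 l s.
Proof.
rewrite /dpsi /psi /=; case: k => [|k]; rewrite /= ?exprS; ring.
Qed.

End Weights.

Section SphereMean.
Context {R : realType} {n : nat}.
Hypothesis n1 : (1 < n)%N.
Implicit Types (x y z w : 'rV[R]_n) (f g : 'rV[R]_n -> R).

Let n0 : (0 < n)%N := ltnW n1.

Definition weighted_mean k f := cube_mean (fun x => f x * psi k 2 (dot x x)).

(** The factor [s^k] pushes the mass to the sphere.  Functions are evaluated in
    the whole closed ball, but only their values near the sphere matter, as
    [sphere_mean_radius] expresses. *)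
Definition sphere_mean f : R :=
  ulim (fun k => weighted_mean k f / weighted_mean k (fun=> 1)).

Definition bounded_ball f := exists M : R, forall x, dot x x <= 1 -> `|f x| <= M.

Lemma bounded_ball_ge0 f : bounded_ball f ->
  exists M : R, 0 <= M /\ forall x, dot x x <= 1 -> `|f x| <= M.
Proof.
move=> [M hM]; exists M; split => //; apply: le_trans (hM 0 _); first exact: normr_ge0.
by rewrite dot0l.
Qed.

Lemma bounded_ballD f g : bounded_ball f -> bounded_ball g ->
  bounded_ball (fun x => f x + g x).
Proof.
move=> [M hM] [N hN]; exists (M + N) => x hx.
by apply: le_trans (ler_normD _ _) _; rewrite lerD ?hM ?hN.
Qed.

Lemma bounded_ballM f g : bounded_ball f -> bounded_ball g ->
  bounded_ball (fun x => f x * g x).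
Proof.
move=> /bounded_ball_ge0 [M [M0 hM]] /bounded_ball_ge0 [N [N0 hN]]; exists (M * N) => x hx.
by rewrite normrM ler_pM // ?hM ?hN.
Qed.

Lemma bounded_ball_cst (c : R) : bounded_ball (fun=> c).
Proof. by exists `|c|. Qed.

Lemma bounded_ball_cont (rho : R) f : 1 < rho ->
  (forall x, ballr rho x -> cont_at f x) -> bounded_ball f.
Proof.
move=> r1 cf; apply: (cont_bounded (K := [set x | dot x x <= 1])).
  exact: cball_compact.
by move=> x hx; apply: cf; exact: le_lt_trans hx r1.
Qed.

Lemma weighted_bounded l k f : bounded_ball f ->
  bounded_cube (fun x => f x * psi k l.+1 (dot x x)).
Proof.
move=> /bounded_ball_ge0 [M [M0 hM]]; exists M => x _.
have [hx|/ltW hx] := leP (dot x x) 1; last by rewrite psi_far // mulr0 normr0.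
rewrite normrM -[X in _ <= X]mulr1; apply: ler_pM => //; first exact: hM.
by rewrite ger0_norm ?psi_ge0 ?dot_ge0 // psi_le1 // dot_ge0.
Qed.

Lemma weighted_meanD k f g : bounded_ball f -> bounded_ball g ->
  weighted_mean k (fun x => f x + g x) = weighted_mean k f + weighted_mean k g.
Proof.
move=> bf bg; rewrite /weighted_mean -cube_meanD; try exact: weighted_bounded; last exact: n0.
by congr cube_mean; apply/funext => x; rewrite mulrDl.
Qed.

Lemma weighted_meanZ k (c : R) f : bounded_ball f ->
  weighted_mean k (fun x => c * f x) = c * weighted_mean k f.
Proof.
move=> bf; rewrite /weighted_mean -cube_meanZ; try exact: weighted_bounded; last exact: n0.
by congr cube_mean; apply/funext => x; rewrite mulrA.
Qed.

Lemma weighted_mean_le k f g : bounded_ball f -> bounded_ball g ->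
  (forall x, dot x x <= 1 -> f x <= g x) -> weighted_mean k f <= weighted_mean k g.
Proof.
move=> bf bg fg; apply: cube_mean_le; try exact: weighted_bounded; first exact: n0.
move=> x _; have [hx|/ltW hx] := leP (dot x x) 1; last by rewrite psi_far // !mulr0.
by apply: ler_wpM2r; [rewrite psi_ge0 // dot_ge0|exact: fg].
Qed.

Lemma weighted_mean_gt0 k : 0 < weighted_mean k (fun=> 1).
Proof.
have nR : (2 : R) <= n%:R by rewrite (ler_nat R 2).
have nR0 : (0 : R) < n%:R by lra.
have nV : n%:R * n%:R^-1 = 1 :> R by rewrite divff // gt_eqF.
have nV0 : 0 < n%:R^-1 :> R by rewrite invr_gt0.
pose q : R := n%:R^-1.
have q0 : 0 < q by []. have q1 : q <= 1 / 2 by rewrite /q; nra.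
apply: (@cube_mean_gt0 _ _ n0 _ ((q / 4) ^+ k * (1 - q) ^+ 2)).
- by apply: weighted_bounded; exact: bounded_ball_cst.
- by move=> x _; rewrite mul1r psi_ge0 // dot_ge0.
- by rewrite mulr_gt0 // exprn_gt0 //; lra.
move=> x hx; rewrite mul1r /psi.
have lo : q / 4 <= dot x x.
  have -> : q / 4 = \sum_(i < n) (q / 2) * (q / 2).
    rewrite sumr_const card_ord -[(_ * _) *+ _]mulr_natl.
    have -> : n%:R * (q / 2 * (q / 2)) = (n%:R * q) * q / 4 by field.
    by rewrite /q nV mul1r.
  apply: ler_sum => i _; have /andP[h _] := hx i.
  have -> : q / 2 = (2 * n%:R)^-1 by rewrite invfM mulrC.
  by apply: ler_pM => //; rewrite invr_ge0; lra.
have hi : dot x x <= q.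
  have -> : q = \sum_(i < n) q * q.
    by rewrite sumr_const card_ord -[(_ * _) *+ _]mulr_natl mulrA /q nV mul1r.
  apply: ler_sum => i _; have /andP[h1 h2] := hx i.
  have x0 : 0 <= x 0 i by apply: le_trans h1; rewrite invr_ge0; lra.
  exact: ler_pM.
apply: ler_pM; rewrite ?exprn_ge0 //; try lra.
  by rewrite lerXn2r ?nnegrE //; lra.
by rewrite pos1_le ?lerXn2r ?nnegrE //; lra.
Qed.

Lemma weighted_mean_norm k f (M : R) : (forall x, dot x x <= 1 -> `|f x| <= M) ->
  `|weighted_mean k f| <= M * weighted_mean k (fun=> 1).
Proof.
move=> hM; have bf : bounded_ball f by exists M.
rewrite ler_norml -mulNr -!weighted_meanZ; try exact: bounded_ball_cst.
apply/andP; split; apply: weighted_mean_le => //; try (by apply: bounded_ballM => //; exact: bounded_ball_cst).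
  by move=> x /hM; rewrite mulr1 ler_norml => /andP[].
by move=> x /hM; rewrite mulr1 ler_norml => /andP[].
Qed.

Lemma ratio_bounded f : bounded_ball f ->
  bounded_seq (fun k => weighted_mean k f / weighted_mean k (fun=> 1)).
Proof.
move=> [M hM]; exists M => k; have p0 := weighted_mean_gt0 k.
rewrite normrM normfV (gtr0_norm p0) ler_pdivrMr //.
exact: weighted_mean_norm.
Qed.

Lemma sphere_meanD f g : bounded_ball f -> bounded_ball g ->
  sphere_mean (fun x => f x + g x) = sphere_mean f + sphere_mean g.
Proof.
move=> bf bg; rewrite /sphere_mean -ulimD; try exact: ratio_bounded.
by congr ulim; apply/funext => k; rewrite weighted_meanD // mulrDl.
Qed.

Lemma sphere_meanZ (c : R) f : bounded_ball f ->
  sphere_mean (fun x => c * f x) = c * sphere_mean f.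
Proof.
move=> bf; rewrite /sphere_mean -ulimZ; try exact: ratio_bounded.
by congr ulim; apply/funext => k; rewrite weighted_meanZ // mulrA.
Qed.

Lemma sphere_mean_le f g : bounded_ball f -> bounded_ball g ->
  (forall x, dot x x <= 1 -> f x <= g x) -> sphere_mean f <= sphere_mean g.
Proof.
move=> bf bg fg; apply: ulim_le; try exact: ratio_bounded.
move=> k; apply: ler_wpM2r; first by rewrite invr_ge0 ltW // weighted_mean_gt0.
exact: weighted_mean_le.
Qed.

Lemma sphere_mean_eq f g : bounded_ball f ->
  (forall x, dot x x <= 1 -> f x = g x) -> sphere_mean f = sphere_mean g.
Proof.
move=> bf fg; have bg : bounded_ball g by have [M hM] := bf; exists M => x hx; rewrite -fg ?hM.
by apply/eqP; rewrite eq_le !sphere_mean_le // => x /fg ->.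
Qed.

Lemma sphere_mean_cst (c : R) : sphere_mean (fun=> c) = c.
Proof.
rewrite (_ : (fun=> c) = (fun x : 'rV[R]_n => c * 1)); last by apply/funext => x; rewrite mulr1.
rewrite sphere_meanZ; last exact: bounded_ball_cst.
rewrite /sphere_mean (_ : (fun k => _) = (fun=> 1)) ?ulim_cst ?mulr1 //.
by apply/funext => k; rewrite divff // gt_eqF // weighted_mean_gt0.
Qed.

Lemma sphere_mean_norm f (M : R) : (forall x, dot x x <= 1 -> `|f x| <= M) ->
  `|sphere_mean f| <= M.
Proof.
move=> hM; have bf : bounded_ball f by exists M.
have bM := bounded_ball_cst M; have bN := bounded_ball_cst (- M).
rewrite ler_norml -{1}(sphere_mean_cst (- M)) -{2}(sphere_mean_cst M).
by rewrite !sphere_mean_le // => x /hM; rewrite ler_norml => /andP[].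
Qed.

(** The divergence of the field [x psi k 3] has mean zero.  Since
    [(1 - s) psi k 2 = psi k 3], this bounds the mean of [1 - |x|^2] by a
    multiple of [1 / k]. *)
Lemma weighted_mean_radius k :
  (n%:R + 2 * k%:R) * weighted_mean k (fun x => 1 - dot x x) <=
  6 * weighted_mean k (fun=> 1).
Proof.
have FD i y : ballr 2 y -> cont_at (fun x : 'rV[R]_n => x 0 i) y /\
     is_derive y (basis_vec i) (fun x : 'rV[R]_n => x 0 i) ((fun _ : 'rV[R]_n => 1) y) /\
     cont_at (fun _ : 'rV[R]_n => 1) y.
  move=> _; split; first exact: cont_coord.
  split; last exact: cont_cst.
  by have := is_derive_coord y (basis_vec i) i; rewrite mxE !eqxx.
have l2 : (1:R) < 2 by rewrite ltr1n.
have div0 := @cube_mean_div _ _ n0 (psi k 3) (dpsi k 3) 2 l2 (is_derive_psi k 1)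
  (@dpsi_cont R k 1) (fun s h => conj (psi_far k 2 h) (dpsi_far k 1 h)) _ _ FD.
have b1 := bounded_ball_cst 1.
have bs : bounded_ball (fun x => dot x x).
  by exists 1 => x hx; rewrite ger0_norm // dot_ge0.
have E : (fun x : 'rV[R]_n => \sum_i (1 * psi k 3 (dot x x) + x 0 i * (dpsi k 3 (dot x x) * (2 * x 0 i)))) =
  (fun x => (n%:R + 2 * k%:R) * ((1 + -1 * dot x x) * psi k 2 (dot x x)) + (- 6) * (dot x x * psi k 2 (dot x x))).
  apply/funext => x; rewrite big_split /= sumr_const card_ord mul1r.
  have -> : \sum_i x 0 i * (dpsi k 3 (dot x x) * (2 * x 0 i)) = 2 * (dot x x * dpsi k 3 (dot x x)).
    rewrite {3}/dot mulr_suml mulr_sumr; apply: eq_bigr => i _; ring.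
  have -> : (1 + -1 * dot x x) * psi k 2 (dot x x) = psi k 3 (dot x x).
    have [hx|/ltW hx] := leP (dot x x) 1; last by rewrite !psi_far // mulr0.
    rewrite /psi pos1_le //; ring.
  rewrite dpsiE -mulr_natl /psi !exprS; ring.
have bZ (c : R) g : bounded_cube g -> bounded_cube (fun x => c * g x).
  by move=> [M hM]; exists (`|c| * M) => x /hM h; rewrite normrM ler_wpM2l.
have bf : bounded_ball (fun x => 1 + -1 * dot x x).
  by apply: bounded_ballD => //; apply: bounded_ballM => //; exact: bounded_ball_cst.
have w1 := weighted_bounded 1 k bf; have w2 := weighted_bounded 1 k bs.
rewrite E cube_meanD ?cube_meanZ //  in div0; try exact: bZ.
have le1 : weighted_mean k (fun x => dot x x) <= weighted_mean k (fun=> 1).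
  exact: weighted_mean_le.
rewrite /weighted_mean in le1 *.
rewrite (_ : (fun x => (1 - dot x x) * _) = (fun x => (1 + -1 * dot x x) * psi k 2 (dot x x))).
  by lra.
by apply/funext => x; rewrite mulN1r.
Qed.

Lemma sphere_mean_radius f : bounded_ball f ->
  sphere_mean (fun x => (1 - dot x x) * f x) = 0.
Proof.
move=> bf; have [M [M0 hM]] := bounded_ball_ge0 bf.
have nR : (1 : R) <= n%:R by rewrite (ler_nat R 1).
apply: ulim_oo; apply/cvgrPdist_le => e e0.
have lim : (6 * M) / (k.+1%:R : R) @[k --> \oo] --> (0:R).
  by rewrite -[X in _ --> X](mulr0 (6 * M)); apply: cvgM; [exact: cvg_cst|exact: cvg_harmonic].
move/cvgrPdist_le : lim => /(_ _ e0); apply: filterS => k; rewrite !sub0r !normrN.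
apply: le_trans.
have kR : (0 : R) < k.+1%:R by rewrite ltr0n.
have p0 := weighted_mean_gt0 k.
rewrite normrM normfV (gtr0_norm p0) ler_pdivrMr // [X in _ <= X * _]ger0_norm; last first.
  by rewrite divr_ge0 // ?mulr_ge0 // ltW.
rewrite mulrAC ler_pdivlMr //.
have bs : bounded_ball (fun x => 1 - dot x x).
  by exists 1 => x hx; have := dot_ge0 x; rewrite ler_norml; lra.
have h1 : `|weighted_mean k (fun x => (1 - dot x x) * f x)| <= M * weighted_mean k (fun x => 1 - dot x x).
  rewrite ler_norml -mulNr -!weighted_meanZ //.
  have bc c := bounded_ballM (bounded_ball_cst c) bs.
  apply/andP; split; apply: weighted_mean_le => //; try exact: bounded_ballM.
    by move=> x hx; have := hM x hx; rewrite ler_norml => /andP [a b]; nra.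
  by move=> x hx; have := hM x hx; rewrite ler_norml => /andP [a b]; nra.
have h2 := weighted_mean_radius k.
have h3 : 0 <= weighted_mean k (fun x => 1 - dot x x).
  rewrite -(mul0r (weighted_mean k (fun=> 1))) -weighted_meanZ; last exact: bounded_ball_cst.
  apply: weighted_mean_le => //; first by apply: bounded_ballM; exact: bounded_ball_cst.
  by move=> x hx; rewrite mul0r subr_ge0.
have k1 : k.+1%:R <= n%:R + 2 * k%:R :> R by rewrite -natr1; have : (0:R) <= k%:R by []; lra.
have := ler_wpM2r (ltW kR) h1 => /le_trans; apply.
rewrite -mulrA [X in _ <= X]mulrAC [X in _ <= X]mulrC.
apply: ler_wpM2l => //; apply: le_trans h2.
by rewrite mulrC; apply: ler_wpM2r.
Qed.

(** The field [|x|^2 F - (x . F) x] is tangent to all spheres, so the divergence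
    of its product with a radial weight does not involve the derivative of the
    weight.  On the unit sphere, the divergence of this field is the function
    below: the tangential divergence of [F] minus [n - 1] times its normal
    component. *)
Lemma sphere_mean_div (rho : R) (F : 'I_n -> 'rV[R]_n -> R)
    (dF : 'I_n -> 'I_n -> 'rV[R]_n -> R) : 1 < rho ->
  (forall i, C1on (ballr rho) (F i) (dF i)) ->
  sphere_mean (fun x => \sum_i dF i i x - \sum_i \sum_j x 0 i * x 0 j * dF i j x
    - (n%:R - 1) * \sum_i x 0 i * F i x) = 0.
Proof.
move=> r1 CF.
pose N x := \sum_j x 0 j * F j x.
pose dN i x := \sum_j ((j == i)%:R * F j x + x 0 j * dF j i x).
have CN : C1on (ballr rho) N dN.
  exact: (@C1on_sum _ _ (ballr rho) _ (index_enum 'I_n) _ _ (fun j => C1onM (C1on_coord (A := ballr rho) j) (CF j))).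
pose V i x := dot x x * F i x + -1 * (x 0 i * N x).
have CV i := C1onD (C1onM (C1on_nsq (A := ballr rho)) (CF i))
  (C1onM (C1on_cst (A := ballr rho) (-1)) (C1onM (C1on_coord (A := ballr rho) i) CN)).
pose D i x := (2 * x 0 i * F i x + dot x x * dF i i x) + (0 * (x 0 i * N x) + -1 * (1 * N x + x 0 i * dN i x)).
have FD i y : ballr rho y -> cont_at (V i) y /\
     is_derive y (basis_vec i) (V i) (D i y) /\ cont_at (D i) y.
  move=> Ay; have [c1 /(_ i)] := CV i y Ay.
  by rewrite eqxx => -[c2 c3]; split.
pose T x := \sum_i dF i i x - \sum_i \sum_j x 0 i * x 0 j * dF i j x - (n%:R - 1) * \sum_i x 0 i * F i x.
have bF i : bounded_ball (F i) by apply: (bounded_ball_cont r1) => x Ax; have [] := CF i x Ax.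
have bdF i j : bounded_ball (dF i j) by apply: (bounded_ball_cont r1) => x Ax; have [_ /(_ j) []] := CF i x Ax.
have btr : bounded_ball (fun x => \sum_i dF i i x).
  apply: (bounded_ball_cont r1) => x Ax; apply: cont_sum => i; by have [_ /(_ i) []] := CF i x Ax.
have bT : bounded_ball T.
  apply: (bounded_ball_cont r1) => x Ax; apply: contD; first apply: contD.
  - by apply: cont_sum => i; have [_ /(_ i) []] := CF i x Ax.
  - apply: contN; apply: cont_sum => i; apply: cont_sum => j; apply: contM.
      by apply: contM; exact: cont_coord.
    by have [_ /(_ j) []] := CF i x Ax.
  - apply: contN; apply: contM; first exact: cont_cst.
    by have [] := CN x Ax.
pose T' x := T x + -1 * ((1 - dot x x) * \sum_i dF i i x).
have bs : bounded_ball (fun x => 1 - dot x x).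
  by exists 1 => x hx; have := dot_ge0 x; rewrite ler_norml; lra.
have T'0 : sphere_mean T' = 0.
  rewrite /sphere_mean (_ : (fun k => _) = (fun=> 0)) ?ulim_cst //.
  apply/funext => k; rewrite [X in X / _](_ : _ = 0) ?mul0r //.
  rewrite -(@cube_mean_div _ _ n0 (psi k 2) (dpsi k 2) rho r1 (is_derive_psi k 0)
    (@dpsi_cont R k 0) (fun s h => conj (psi_far k 1 h) (dpsi_far k 0 h)) _ _ FD).
  congr cube_mean; apply/funext => x.
  rewrite big_split /= -mulr_suml.
  have -> : \sum_i V i x * (dpsi k 2 (dot x x) * (2 * x 0 i)) = 0.
    rewrite (eq_bigr (fun i => (2 * dpsi k 2 (dot x x)) * (dot x x * (x 0 i * F i x) + - N x * (x 0 i * x 0 i)))).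
      by rewrite -mulr_sumr big_split /= -!mulr_sumr -/(dot x x) -/(N x); ring.
    by move=> i _; rewrite /V; ring.
  rewrite addr0; congr (_ * _).
  have dNE i : dN i x = F i x + \sum_j x 0 j * dF j i x.
    rewrite /dN big_split /= (bigD1 i) //= eqxx big1 ?addr0 ?mul1r //.
    by move=> j /negbTE ->; rewrite mul0r.
  have radial : \sum_i x 0 i * dN i x = N x + \sum_i \sum_j x 0 i * x 0 j * dF i j x.
    rewrite (eq_bigr (fun i => x 0 i * F i x + \sum_j x 0 j * x 0 i * dF j i x)).
      by rewrite big_split /= [X in _ + X]exchange_big.
    by move=> i _; rewrite dNE mulrDr mulr_sumr; congr (_ + _); apply: eq_bigr => j _; ring.
  rewrite (eq_bigr (fun i => 2 * (x 0 i * F i x) + dot x x * dF i i x + - N x + - (x 0 i * dN i x))); last first.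
    by move=> i _; rewrite /D; ring.
  rewrite !big_split /= !sumrN radial sumr_const card_ord -/(N x) -[N x *+ n]mulr_natl /T' /T -/(N x).
  rewrite -[X in _ = X + _ + _ + _]mulr_sumr -[X in _ = _ + X + _ + _]mulr_sumr -/(N x).
  by move: (\sum_i \sum_j _) (\sum_i dF i i x) => Q tr; ring.
have E : sphere_mean T = sphere_mean (fun x => T' x + (1 - dot x x) * \sum_i dF i i x).
  by apply: sphere_mean_eq => // x _; rewrite /T'; ring.
have bq := bounded_ballM bs btr.
rewrite -/T E sphere_meanD // ?T'0 ?sphere_mean_radius ?addr0 //.
by apply: bounded_ballD => //; apply: bounded_ballM => //; exact: bounded_ball_cst.
Qed.

End SphereMean.

(** * The mean of the distance of a coordinate to a constant *)

Section Profile.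
Context {R : realType}.
Implicit Types a c s t u : R.

Definition bend a u := u ^+ 2 / (a + u).
Definition dbend a u := (2 * a * u + u ^+ 2) / (a + u) ^+ 2.

Lemma is_derive_bend a u : 0 < a -> 0 <= u -> is_derive u 1 (bend a) (dbend a u).
Proof.
move=> a0 u0.
have ne : a + u != 0 by rewrite gt_eqF //; lra.
have D1 : is_derive u 1 (fun t : R => t ^+ 2) (2 * u).
  apply: DeriveDef; first exact: exprn_derivable.
  by rewrite exp_derive /GRing.scale /= mulr1 expr1.
have E := @is_deriveD R R R (cst a) id u 1 0 1 (is_derive_cst _ _ _) (is_derive_id _ _).
have D2 : is_derive u 1 (fun t : R => (a + t)^-1) (- (a + u) ^- 2).
  case: E => E1 E2; apply: DeriveDef; first exact: (@derivableV _ _ (fun t => a + t)).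
  rewrite (@deriveV _ _ (fun t => a + t)) //.
  by rewrite [X in _ *: X]E2 add0r /GRing.scale /= mulr1.
have H := @is_deriveM _ _ (fun t : R => t ^+ 2) (fun t => (a + t)^-1) u 1 _ _ D1 D2.
apply: (@is_derive_eq _ _ _ _ _ _ _ _ H).
by rewrite /dbend /GRing.scale /=; field.
Qed.

Lemma dbend0 a : dbend a 0 = 0.
Proof. by rewrite /dbend expr0n /= !mulr0 addr0 mul0r. Qed.

Lemma is_derive_bend_pos a u : 0 < a ->
  is_derive u 1 (fun t => bend a (Num.max 0 t)) (dbend a (Num.max 0 u)).
Proof. by move=> a0; apply: is_derive_pospart (dbend0 a) => t; exact: is_derive_bend. Qed.

Lemma dbend_pos_cont a : 0 < a -> continuous (fun u => dbend a (Num.max 0 u)).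
Proof.
move=> a0 u.
have cm : Num.max 0 t @[t --> u] --> Num.max 0 u.
  have h := @continuous_max R R (fun=> 0) id u; apply: h; first exact: cvg_cst.
  exact: cvg_id.
have sq (f : R -> R) (l : R) : f t @[t --> u] --> l -> f t ^+ 2 @[t --> u] --> l ^+ 2.
  move=> h; rewrite expr2 (_ : (fun t => f t ^+ 2) = (fun t => f t * f t)); first exact: cvgM.
  by apply/funext => t; rewrite expr2.
have ge0 : 0 <= Num.max 0 u by rewrite le_max lexx.
apply: cvgM.
  apply: cvgD; last exact: sq cm.
  by apply: cvgM => //; exact: cvg_cst.
apply: cvgV; first by rewrite expf_neq0 // gt_eqF //; lra.
apply: sq; by apply: cvgD => //; exact: cvg_cst.
Qed.

(** The solution, bounded at both poles, of
    [(1 - t^2) g' - 2 t g = (1 + c^2) / 2 - |t - c|]: the right-hand side has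
    mean zero for the uniform law on [-1, 1], which is the law of a coordinate
    on the two-sphere.  It equals [((1 - c)^2 / (1 - t) - 1) / 2] for [t <= c]
    and [(1 - (1 + c)^2 / (1 + t)) / 2] for [c <= t]; the form below displays
    it as an affine function plus two terms that are smooth across [t = c]. *)
Definition profile c t :=
  2^-1 * (t - 2 * c + bend (1 - c) (Num.max 0 (c - t)) - bend (1 + c) (Num.max 0 (t - c))).

Definition dprofile c t :=
  2^-1 * (1 - dbend (1 - c) (Num.max 0 (c - t)) - dbend (1 + c) (Num.max 0 (t - c))).

Lemma is_derive_profile c t : `|c| < 1 -> is_derive t 1 (profile c) (dprofile c t).
Proof.
rewrite ltr_norml => /andP [c1 c2].
have Ip s : is_derive t 1 (fun u : R => u - s) 1.
  have E := @is_deriveB R R R id (cst s) t 1 1 0 (is_derive_id _ _) (is_derive_cst _ _ _).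
  by apply: (@is_derive_eq _ _ _ _ _ _ _ _ E); exact: subr0.
have Im s : is_derive t 1 (fun u : R => s - u) (-1).
  have E := @is_deriveB R R R (cst s) id t 1 0 1 (is_derive_cst _ _ _) (is_derive_id _ _).
  by apply: (@is_derive_eq _ _ _ _ _ _ _ _ E); exact: sub0r.
have a1 : 0 < 1 - c by lra.
have a2 : 0 < 1 + c by lra.
have B1 := @is_derive1_comp R _ _ t _ _ (is_derive_bend_pos (c - t) a1) (Im c).
have B2 := @is_derive1_comp R _ _ t _ _ (is_derive_bend_pos (t - c) a2) (Ip c).
have H := is_deriveZ 2^-1 (is_deriveB (is_deriveD (Ip (2 * c)) B1) B2).
apply: (@is_derive_eq _ _ _ _ _ _ _ _ H).
by rewrite /dprofile mulrN1 mulr1.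
Qed.

Lemma dprofile_cont c : `|c| < 1 -> continuous (dprofile c).
Proof.
rewrite ltr_norml => /andP [c1 c2] t.
have a1 : 0 < 1 - c by lra.
have a2 : 0 < 1 + c by lra.
apply: cvgM; first exact: cvg_cst.
apply: cvgB; first (apply: cvgB; first exact: cvg_cst).
  apply: (@cvg_comp _ _ _ (fun u => c - u) (fun u => dbend (1 - c) (Num.max 0 u)) _ (nbhs (c - t))).
    by apply: cvgB; [exact: cvg_cst|exact: cvg_id].
  exact: dbend_pos_cont.
apply: (@cvg_comp _ _ _ (fun u => u - c) (fun u => dbend (1 + c) (Num.max 0 u)) _ (nbhs (t - c))).
  by apply: cvgB; [exact: cvg_id|exact: cvg_cst].
exact: dbend_pos_cont.
Qed.

Lemma profile_ode c t : `|c| < 1 -> `|t| <= 1 ->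
  `|t - c| + (1 - t ^+ 2) * dprofile c t - 2 * t * profile c t = (1 + c ^+ 2) / 2.
Proof.
rewrite ltr_norml ler_norml => /andP [c1 c2] /andP [t1 t2].
rewrite /dprofile /profile; have [h|h] := leP t c.
  rewrite (@max_r _ _ 0 (c - t)) ?subr_ge0 // (@max_l _ _ 0 (t - c)) ?subr_le0 //.
  rewrite ler0_norm ?subr_le0 // dbend0 /bend /dbend.
  have n1 : 1 - t != 0 by rewrite gt_eqF //; lra.
  have n2 : 1 + c != 0 by rewrite gt_eqF //; lra.
  have -> : 1 - c + (c - t) = 1 - t by ring.
  by field; rewrite n1 n2.
rewrite (@max_l _ _ 0 (c - t)) ?subr_le0 ?(ltW h) // (@max_r _ _ 0 (t - c)) ?subr_ge0 ?(ltW h) //.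
rewrite gtr0_norm ?subr_gt0 // dbend0 /bend /dbend.
have n1 : 1 + t != 0 by rewrite gt_eqF //; lra.
have n2 : 1 - c != 0 by rewrite gt_eqF //; lra.
have -> : 1 + c + (t - c) = 1 + t by ring.
by field; rewrite n1 n2.
Qed.

Lemma dprofile_ge c t : `|c| < 1 -> `|t| <= 1 -> (1 - `|c|) ^+ 2 / 8 <= dprofile c t.
Proof.
move=> hc; have := hc; rewrite ltr_norml ler_norml => /andP [c1 c2] /andP [t1 t2].
have ca : c <= `|c| by exact: ler_norm.
have cb : - c <= `|c| by rewrite -normrN; exact: ler_norm.
rewrite /dprofile; have [h|h] := leP t c.
  rewrite (@max_r _ _ 0 (c - t)) ?subr_ge0 // (@max_l _ _ 0 (t - c)) ?subr_le0 //.
  rewrite dbend0 /dbend.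
  have n1 : 0 < 1 - t by lra.
  have -> : 1 - c + (c - t) = 1 - t by ring.
  have -> : 2^-1 * (1 - (2 * (1 - c) * (c - t) + (c - t) ^+ 2) / (1 - t) ^+ 2 - 0) = (1 - c) ^+ 2 / (2 * (1 - t) ^+ 2).
    by field; rewrite gt_eqF.
  rewrite ler_pdivlMr ?mulr_gt0 ?exprn_gt0 //.
  have : (1 - t) ^+ 2 <= 4 by nra.
  have : (1 - `|c|) ^+ 2 <= (1 - c) ^+ 2 by nra.
  have : 0 <= (1 - `|c|) ^+ 2 by exact: sqr_ge0.
  nra.
rewrite (@max_l _ _ 0 (c - t)) ?subr_le0 ?(ltW h) // (@max_r _ _ 0 (t - c)) ?subr_ge0 ?(ltW h) //.
rewrite dbend0 /dbend.
have n1 : 0 < 1 + t by lra.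
have -> : 1 + c + (t - c) = 1 + t by ring.
have -> : 2^-1 * (1 - 0 - (2 * (1 + c) * (t - c) + (t - c) ^+ 2) / (1 + t) ^+ 2) = (1 + c) ^+ 2 / (2 * (1 + t) ^+ 2).
  by field; rewrite gt_eqF.
rewrite ler_pdivlMr ?mulr_gt0 ?exprn_gt0 //.
have : (1 + t) ^+ 2 <= 4 by nra.
have : (1 - `|c|) ^+ 2 <= (1 + c) ^+ 2 by nra.
have : 0 <= (1 - `|c|) ^+ 2 by exact: sqr_ge0.
nra.
Qed.

(** A quantitative form of the fact that [profile] increases: this is where the
    gain in dimension at least four comes from. *)
Lemma profile_incr c t : `|c| < 1 -> `|t| <= 1 ->
  (1 - `|c|) ^+ 2 / 8 * t ^+ 2 <= t * (profile c t - profile c 0).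
Proof.
move=> hc ht.
have [s _|xi xit ->] := @mvt_abs R (profile c) (dprofile c) t; first exact: is_derive_profile.
have := dprofile_ge hc (le_trans xit ht); have := sqr_ge0 t.
have E p : t * (p * t) = p * t ^+ 2 by ring.
by rewrite E => t2 /(ler_wpM2r t2).
Qed.
End Profile.

Section MeanAbs.
Context {R : realType} {n : nat}.
Hypothesis n3 : (2 < n)%N.
Implicit Types (x y z w : 'rV[R]_n) (f g : 'rV[R]_n -> R).

Let n1 : (1 < n)%N := ltnW n3.

Lemma dot_bounded w : bounded_ball (fun x => dot x w).
Proof.
apply: (@bounded_ball_cont _ _ 2); first by rewrite ltr1n.
by move=> x _; exact: dotr_cont.
Qed.

(** The spherical divergence theorem for the field [G (x . w) w]. *)
Lemma sphere_mean_ridge w (G dG : R -> R) : dot w w = 1 ->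
  (forall s : R, is_derive s 1 G (dG s)) -> continuous dG ->
  sphere_mean (fun x => dG (dot x w) - dot x w ^+ 2 * dG (dot x w)
    - (n%:R - 1) * (dot x w * G (dot x w))) = 0.
Proof.
move=> w1 dGP cdG.
have l2 : (1 : R) < 2 by rewrite ltr1n.
have C i := C1onM (C1on_cst (A := ballr 2) (w 0 i)) (C1on_comp1 (C1on_dot (A := ballr 2) w) dGP cdG).
rewrite -[RHS](sphere_mean_div n1 l2 C).
congr sphere_mean; apply/funext => x.
congr (_ - _ - _ * _).
- rewrite (eq_bigr (fun i => dG (dot x w) * (w 0 i * w 0 i))).
    by rewrite -mulr_sumr -/(dot w w) w1 mulr1.
  by move=> i _; ring.
- rewrite (eq_bigr (fun i => (x 0 i * w 0 i) * (dot x w * dG (dot x w)))).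
    by rewrite -mulr_suml -/(dot x w); ring.
  move=> i _; rewrite (eq_bigr (fun j => (x 0 j * w 0 j) * (x 0 i * w 0 i * dG (dot x w)))).
    by rewrite -mulr_suml -/(dot x w); ring.
  by move=> j _; ring.
- rewrite (eq_bigr (fun i => (x 0 i * w 0 i) * G (dot x w))).
    by rewrite -mulr_suml.
  by move=> i _; ring.
Qed.

(** The field [w]: here [G = 1]. *)
Lemma sphere_mean_dot w : dot w w = 1 -> sphere_mean (fun x => dot x w) = 0.
Proof.
move=> w1.
have nR : (3 : R) <= n%:R by rewrite (ler_nat R 3).
have := sphere_mean_ridge w1 (fun s => is_derive_cst (1 : R) s 1) (@cst_continuous _ _ (0 : R)).
rewrite (_ : (fun x => _) = (fun x => (1 - n%:R) * dot x w)).
  rewrite sphere_meanZ //; last exact: dot_bounded.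
  by move/eqP; rewrite mulf_eq0 => /orP [/eqP|/eqP //]; lra.
by apply/funext => x /=; ring.
Qed.

(** The field [(x . w) w]: here [G] is the identity. *)
Lemma sphere_mean_dot2 w : dot w w = 1 -> sphere_mean (fun x => dot x w ^+ 2) = n%:R^-1.
Proof.
move=> w1.
have nR : (3 : R) <= n%:R by rewrite (ler_nat R 3).
have := sphere_mean_ridge w1 (fun s => is_derive_id s (1:R)) (@cst_continuous _ _ (1 : R)).
have bd := dot_bounded w; have bd2 := bounded_ballM bd bd.
rewrite (_ : (fun x => _) = (fun x => 1 + - n%:R * (dot x w * dot x w))).
  rewrite sphere_meanD //; try exact: bounded_ballM (bounded_ball_cst _) bd2; try exact: bounded_ball_cst.
  rewrite sphere_mean_cst // sphere_meanZ // => e.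
  rewrite (_ : (fun x => dot x w ^+ 2) = (fun x => dot x w * dot x w)); last by apply/funext => x; rewrite expr2.
  have : n%:R * sphere_mean (fun x => dot x w * dot x w) = 1 by lra.
  have nz : n%:R != 0 :> R by rewrite gt_eqF //; lra.
  by move=> h; apply: (mulfI nz); rewrite h divff.
by apply/funext => x /=; ring.
Qed.

(** For [n = 3] this is an equality, the coordinate being uniform on [-1, 1];
    in higher dimensions the law of the coordinate is more concentrated.  In
    terms of [g = profile c - profile c 0] and [t = x . w], the equation of
    [profile] writes [|t - c|] as [(1 + c^2) / 2] minus a spherical divergence,
    minus [(n - 3) t g(t)], up to a multiple of [t]; the last term is at least
    a multiple of [t^2], whose mean is [1 / n].  Subtracting [profile c 0] is
    what gives [t g(t)] a sign. *)
Lemma sphere_mean_abs w (c : R) : dot w w = 1 -> `|c| < 1 ->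
  sphere_mean (fun x => `|dot x w - c|) <=
  (1 + c ^+ 2) / 2 - (n%:R - 3) / n%:R * ((1 - `|c|) ^+ 2 / 8).
Proof.
move=> w1 hc.
have nR : (3 : R) <= n%:R by rewrite (ler_nat R 3).
set kap : R := (1 - `|c|) ^+ 2 / 8.
pose G (t : R) : R := profile c t - profile c 0.
have dG (s : R) : is_derive s 1 G (dprofile c s).
  have E := @is_deriveB R R R (profile c) (cst (profile c 0)) s 1 _ 0 (is_derive_profile s hc) (is_derive_cst _ _ _).
  by apply: (@is_derive_eq _ _ _ _ _ _ _ _ E); exact: subr0.
pose Z x := dprofile c (dot x w) - dot x w ^+ 2 * dprofile c (dot x w) - (n%:R - 1) * (dot x w * G (dot x w)).
have Z0 : sphere_mean Z = 0 := sphere_mean_ridge w1 dG (dprofile_cont hc).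
have bd := dot_bounded w.
have bd2 : bounded_ball (fun x => dot x w ^+ 2).
  have [M hM] := bounded_ballM bd bd; exists M => x; rewrite expr2; exact: hM.
have cG : continuous G.
  by move=> s; apply/differentiable_continuous/derivable1_diffP; have [] := dG s.
have bZ : bounded_ball Z.
  apply: (@bounded_ball_cont _ _ 2); first by rewrite ltr1n.
  move=> x _; have ct := @dotr_cont R n w x.
  have c1 : cont_at (fun x => dprofile c (dot x w)) x by apply: cont_comp1 => //; exact: dprofile_cont.
  have c2 : cont_at (fun x => G (dot x w)) x by apply: cont_comp1 => //; exact: cG.
  apply: contD; last (apply: contN; apply: contM; [exact: cont_cst|exact: contM]).
  apply: contD => //; apply: contN; apply: contM => //.
  rewrite (_ : (fun x => dot x w ^+ 2) = (fun x => dot x w * dot x w)); first exact: contM.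
  by apply/funext => y; rewrite expr2.
have bl : bounded_ball (fun x => 2 * profile c 0 * dot x w) by apply: bounded_ballM => //; exact: bounded_ball_cst.
have bk : bounded_ball (fun x => - ((n%:R - 3) * kap) * dot x w ^+ 2) by apply: bounded_ballM => //; exact: bounded_ball_cst.
have bc := @bounded_ball_cst R n ((1 + c ^+ 2) / 2).
have bz : bounded_ball (fun x => -1 * Z x) by apply: bounded_ballM => //; exact: bounded_ball_cst.
apply: (@le_trans _ _ (sphere_mean (fun x => ((1 + c ^+ 2) / 2 + -1 * Z x) +
    (2 * profile c 0 * dot x w + - ((n%:R - 3) * kap) * dot x w ^+ 2)))); last first.
  rewrite !sphere_meanD //; try (by apply: bounded_ballD).
  rewrite sphere_mean_cst // !sphere_meanZ // Z0 sphere_mean_dot // sphere_mean_dot2 //.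
  rewrite mulr0 addr0 mulr0 add0r.
  by rewrite le_eqVlt; apply/orP; left; apply/eqP; rewrite mulNr mulrAC.
apply: sphere_mean_le => //.
- have [M hM] := bounded_ballD bd (bounded_ball_cst (- c)); exists M => x /hM.
  by rewrite normr_id.
- by apply: bounded_ballD; apply: bounded_ballD.
move=> x hx.
have ht : `|dot x w| <= 1.
  rewrite -[X in X <= _]normr_id; have := dot_CS x w; rewrite w1 mulr1 => h.
  have : dot x w ^+ 2 <= 1 by exact: le_trans h hx.
  by rewrite normr_id ler_norml; nra.
have := profile_ode hc ht; have := profile_incr hc ht; rewrite -/kap -/(G _) /Z.
move: (dot x w) ht => t ht.
have : 0 <= n%:R - 3 :> R by lra.
move=> n3' /(ler_wpM2l n3') h e.
have -> : `|t - c| = (1 + c ^+ 2) / 2 - (1 - t ^+ 2) * dprofile c t + 2 * t * profile c t by lra.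
have -> : profile c t = G t + profile c 0 by rewrite /G subrK.
nra.
Qed.

End MeanAbs.

(** * Means over spheres of varying radius *)

Section MeanDeriv.
Context {R : realType} {n : nat}.
Hypothesis n1 : (1 < n)%N.
Implicit Types (x y z w : 'rV[R]_n) (f g : 'rV[R]_n -> R).

Lemma sphere_mean_sum I (r : seq I) (f : I -> 'rV[R]_n -> R) :
  (forall k, bounded_ball (f k)) ->
  bounded_ball (fun x => \sum_(k <- r) f k x) /\
  sphere_mean (fun x => \sum_(k <- r) f k x) = \sum_(k <- r) sphere_mean (f k).
Proof.
move=> bf; elim: r => [|k r [IH1 IH2]].
  rewrite (_ : (fun x => _) = (fun=> 0)); last by apply/funext => x; rewrite big_nil.
  by rewrite big_nil sphere_mean_cst //; split => //; exact: bounded_ball_cst.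
rewrite (_ : (fun x => _) = (fun x => f k x + \sum_(j <- r) f j x)); last by apply/funext => x; rewrite big_cons.
by rewrite big_cons sphere_meanD // IH2; split => //; exact: bounded_ballD.
Qed.

(** A squared radius larger than 1 such that dilation by [r] still maps the ball
    into the unit ball; [r^-2] would do except at [r = 0]. *)
Definition dilation_radius (r : R) := 2 / (1 + r ^+ 2).

Lemma dilation_radius_gt1 (r : R) : `|r| < 1 -> 1 < dilation_radius r.
Proof.
rewrite ltr_norml => /andP[a b]; have h : 0 < 1 + r ^+ 2 by nra.
by rewrite /dilation_radius ltr_pdivlMr // mul1r; nra.
Qed.

Lemma dilation_radius_ball (r : R) x : `|r| < 1 -> ballr (dilation_radius r) x -> ballr 1 (r *: x).
Proof.
rewrite /ballr /= dotZl dotZr ltr_norml => /andP[a b]; have h : 0 < 1 + r ^+ 2 by nra.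
rewrite /dilation_radius ltr_pdivlMr // => h1; have := dot_ge0 x; nra.
Qed.

Lemma C1on_dilate (r : R) f p : `|r| < 1 -> C1on (ballr 1) f p ->
  C1on (ballr (dilation_radius r)) (fun x => f (r *: x)) (fun i x => r * p i (r *: x)).
Proof.
move=> r1 F.
have Q k : C1on (ballr (dilation_radius r)) (fun x : 'rV[R]_n => (r *: x) 0 k) (fun i _ => r * (k == i)%:R).
  refine (C1on_ext (C1onM (C1on_cst (A := ballr (dilation_radius r)) r) (C1on_coord (A := ballr (dilation_radius r)) k)) _ _).
    by move=> y; rewrite mxE.
  by move=> i y; rewrite mul0r add0r.
have H := C1on_comp (@ballr_open R n 1) F (fun y => @dilation_radius_ball r y r1) Q.
refine (C1on_ext H _ _) => // i y.
rewrite (bigD1 i) //= eqxx mulr1 big1 ?addr0; first by rewrite mulrC.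
by move=> j /negbTE ->; rewrite !mulr0.
Qed.

Lemma bounded_ball_dilate (r : R) f : `|r| < 1 ->
  (forall y, ballr 1 y -> cont_at f y) -> bounded_ball (fun x => f (r *: x)).
Proof.
move=> r1 cf; apply: (bounded_ball_cont (dilation_radius_gt1 r1)) => x Ax.
apply: (@cvg_comp _ _ _ (fun x => r *: x) f _ (nbhs (r *: x))).
  exact: (@scaler_continuous _ _ r x).
by apply: cf; exact: dilation_radius_ball.
Qed.

Lemma coord_bounded i : bounded_ball (fun x : 'rV[R]_n => x 0 i).
Proof.
by apply: (@bounded_ball_cont _ _ 2); [rewrite ltr1n|move=> x _; exact: cont_coord].
Qed.

Lemma in_dilate (s : R) x : `|s| < 1 -> dot x x <= 1 -> ballr 1 (s *: x).
Proof.
rewrite /ballr /= dotZl dotZr ltr_norml => /andP[a b] h.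
have := dot_ge0 x; nra.
Qed.

(** Differentiation under the mean: compactness of the closed ball makes the
    difference quotients converge uniformly. *)
Lemma sphere_mean_deriv f p (om : 'rV[R]_n -> R) (r : R) : C1on (ballr 1) f p -> bounded_ball om -> `|r| < 1 ->
  is_derive r 1 (fun s => sphere_mean (fun x => f (s *: x) * om x))
    (sphere_mean (fun x => (\sum_i p i (r *: x) * x 0 i) * om x)).
Proof.
move=> F bw r1.
have [M [M0 hM]] := bounded_ball_ge0 bw.
pose P s x := \sum_i p i (s *: x) * x 0 i.
have bP s : `|s| < 1 -> bounded_ball (P s).
  move=> s1; apply: (sphere_mean_sum _ _).1 => i.
  apply: bounded_ballM; last exact: coord_bounded.
  by apply: bounded_ball_dilate => // y Ay; have [_ /(_ i) []] := F y Ay.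
have bf s : `|s| < 1 -> bounded_ball (fun x => f (s *: x)).
  by move=> s1; apply: bounded_ball_dilate => // y Ay; have [] := F y Ay.
have unif (e : R) : 0 < e -> \forall t \near (0 : R), [set x | dot x x <= 1] `<=` (fun x => `|P (r + t) x - P r x| <= e).
  move=> e0; have cc := @cball_compact R n; rewrite compact_near_coveringP in cc.
  have := cc R (nbhs (0:R)) (fun t x => `|P (r + t) x - P r x| <= e) _; apply => x hx.
  have cs : ((r + q.2) *: q.1) @[q --> (x, (0:R))] --> (r + 0) *: x.
    apply: (@cvgZ _ _ _ (filter_prod (nbhs x) (nbhs (0:R))) _ (fun q => r + q.2) fst); last exact: cvg_fst.
    apply: (@cvgD _ _ _ (filter_prod (nbhs x) (nbhs (0:R))) _ (fun=> r) snd); [exact: cvg_cst|exact: cvg_snd].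
  have cs' : (r *: q.1) @[q --> (x, (0:R))] --> r *: x.
    apply: (@cvgZl_tmp _ _ _ (filter_prod (nbhs x) (nbhs (0:R))) _ r fst); exact: cvg_fst.
  rewrite addr0 in cs.
  have cP : (P (r + q.2) q.1 - P r q.1) @[q --> (x, (0:R))] --> P r x - P r x.
    have cx (i : 'I_n) : ((q.1 : 'rV[R]_n) 0 i) @[q --> (x, (0:R))] --> x 0 i.
      by apply: (@cvg_comp _ _ _ fst (fun x : 'rV[R]_n => x 0 i) (filter_prod (nbhs x) (nbhs (0:R))) (nbhs x)); [exact: cvg_fst|exact: cont_coord].
    have cpi i : cont_at (p i) (r *: x) by have [_ /(_ i) []] := F _ (in_dilate r1 hx).
    apply: (@cvgB _ _ _ (filter_prod (nbhs x) (nbhs (0:R))) _ (fun q => P (r + q.2) q.1) (fun q => P r q.1)).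
      have := @cvg_sumr R _ _ (filter_prod (nbhs x) (nbhs (0:R))) _ (index_enum 'I_n) (fun i (q : 'rV[R]_n * R) => p i ((r + q.2) *: q.1) * q.1 0 i); apply => i.
      apply: (@cvgM _ _ (filter_prod (nbhs x) (nbhs (0:R))) _ (fun q => p i ((r + q.2) *: q.1))); last exact: cx.
      by apply: (@cvg_comp _ _ _ (fun q => (r + q.2) *: q.1) (p i) _ (nbhs (r *: x))); [exact: cs|exact: cpi].
    have := @cvg_sumr R _ _ (filter_prod (nbhs x) (nbhs (0:R))) _ (index_enum 'I_n) (fun i (q : 'rV[R]_n * R) => p i (r *: q.1) * q.1 0 i); apply => i.
    apply: (@cvgM _ _ (filter_prod (nbhs x) (nbhs (0:R))) _ (fun q => p i (r *: q.1))); last exact: cx.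
    by apply: (@cvg_comp _ _ _ (fun q => r *: q.1) (p i) _ (nbhs (r *: x))); [exact: cs'|exact: cpi].
  rewrite subrr in cP.
  move/(@cvgrPdist_le _ _ _ (filter_prod (nbhs x) (nbhs (0:R))) _) : cP => /(_ _ e0).
  by apply: (@filterS _ (filter_prod (nbhs x) (nbhs (0:R)))) => -[y t] /=; rewrite sub0r normrN.
have bm (c : R) (g : 'rV[R]_n -> R) : bounded_ball g -> bounded_ball (fun x => c * g x).
  by move=> bg; exact: bounded_ballM (bounded_ball_cst c) bg.
have lim : h^-1 *: (sphere_mean (fun x => f ((h *: (1:R) + r) *: x) * om x) - sphere_mean (fun x => f (r *: x) * om x)) @[h --> 0^'] -->
   sphere_mean (fun x => P r x * om x).
  apply/cvgrPdist_le => e e0.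
  have eM : 0 < e / (M + 1) by rewrite divr_gt0 //; lra.
  have [d /= d0 dP] := unif _ eM.
  have r10 : 0 < 1 - `|r| by lra.
  near=> h.
  have h0 : h != 0 by near: h; exact: nbhs_dnbhs_neq.
  have hd : `|h| < d by near: h; exact: dnbhs0_lt.
  have hr : `|h| < 1 - `|r| by near: h; exact: dnbhs0_lt.
  rewrite [h%:A]mulr1 (addrC h r) distrC.
  have rs s : `|s| <= `|h| -> `|r + s| < 1.
    by move=> hs; apply: le_lt_trans (ler_normD _ _) _; lra.
  have b1 := bounded_ballM (bf _ (rs h (lexx _))) bw; have b2 := bounded_ballM (bf _ r1) bw.
  have b3 := bounded_ballM (bP _ r1) bw.
  have -> : h^-1 *: (sphere_mean (fun x => f ((r + h) *: x) * om x) - sphere_mean (fun x => f (r *: x) * om x)) - sphere_mean (fun x => P r x * om x) =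
    sphere_mean (fun x => h^-1 * (f ((r + h) *: x) * om x + -1 * (f (r *: x) * om x)) + -1 * (P r x * om x)).
    have b4 := bounded_ballD b1 (bm (-1) _ b2).
    rewrite sphere_meanD //; try exact: bm.
    rewrite !sphere_meanZ // sphere_meanD //; try exact: bm.
    by rewrite sphere_meanZ // !mulN1r.
  apply: sphere_mean_norm => // x hx.
  have [s sh|xi xih E] := @mvt_abs R (fun s => f (r *: x + s *: x)) (fun s => P (r + s) x) h.
    have As := in_dilate (rs s sh) hx; rewrite scalerDl in As.
    have := C1on_dir x (@ballr_open R n 1) F As.
    move/is_derive_line => /is_derive_eq; apply.
    by apply: eq_bigr => i _; rewrite scalerDl.
  rewrite -!scalerDl addr0 in E.
  have -> : h^-1 * (f ((r + h) *: x) * om x + -1 * (f (r *: x) * om x)) + -1 * (P r x * om x) = (P (r + xi) x - P r x) * om x.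
    have -> : f ((r + h) *: x) = f (r *: x) + P (r + xi) x * h by rewrite -E; ring.
    by field.
  rewrite normrM.
  have a1 : `|P (r + xi) x - P r x| <= e / (M + 1).
    by apply: dP => //=; rewrite sub0r normrN; exact: le_lt_trans xih hd.
  apply: le_trans (ler_pM _ _ a1 (hM x hx)) _ => //.
  by rewrite mulrAC ler_pdivrMr; nra.
apply: DeriveDef; first by apply/cvg_ex; eexists; exact: lim.
by rewrite /derive; exact: cvg_lim lim.
Unshelve. all: by end_near. Qed.

End MeanDeriv.

Section RealCalculus.
Context {R : realType}.
Implicit Types (f g : R -> R) (x a b c : R).

Lemma derM f g x a b : is_derive x 1 f a -> is_derive x 1 g b ->
  is_derive x 1 (fun t => f t * g t) (a * g x + f x * b).
Proof.
move=> F G; have H := @is_deriveM _ _ f g x 1 _ _ F G.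
apply: (@is_derive_eq _ _ _ _ _ _ _ _ H).
by rewrite addrC; congr (_ + _); exact: mulrC.
Qed.

Lemma derD f g x a b : is_derive x 1 f a -> is_derive x 1 g b ->
  is_derive x 1 (fun t => f t + g t) (a + b).
Proof. by move=> F G; exact: (@is_deriveD _ _ _ f g x 1 _ _ F G). Qed.

Lemma derZ c f x a : is_derive x 1 f a -> is_derive x 1 (fun t => c * f t) (c * a).
Proof. by move=> F; exact: (@is_deriveZ _ _ _ f c x 1 _ F). Qed.

Lemma derB f g x a b : is_derive x 1 f a -> is_derive x 1 g b ->
  is_derive x 1 (fun t => f t - g t) (a - b).
Proof. by move=> F G; exact: (@is_deriveB _ _ _ f g x 1 _ _ F G). Qed.

Lemma derX f x a k : is_derive x 1 f a ->
  is_derive x 1 (fun t => f t ^+ k.+1) (k.+1%:R * f x ^+ k * a).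
Proof.
move=> F; elim: k => [|k IH].
  apply: (@is_derive_eq _ _ _ _ _ _ _ _ F); by rewrite expr0 !mul1r.
have H := derM F IH; rewrite (_ : (fun t => f t ^+ k.+2) = (fun t => f t * f t ^+ k.+1)).
  apply: (@is_derive_eq _ _ _ _ _ _ _ _ H).
  by rewrite -[k.+2%:R]natr1 !exprS; ring.
by apply/funext => t; rewrite exprS.
Qed.

Lemma der_id x : is_derive x 1 (fun t : R => t) 1.
Proof. exact: is_derive_id. Qed.

Lemma der_cst c x : is_derive x 1 (fun=> c) (0 : R).
Proof. exact: is_derive_cst. Qed.

Lemma derV f x a : is_derive x 1 f a -> f x != 0 ->
  is_derive x 1 (fun t => (f t)^-1) (- a * ((f x)^-1) ^+ 2).
Proof.
move=> [F1 F2] n0; apply: DeriveDef; first exact: derivableV.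
rewrite deriveV // F2 /GRing.scale /= exprVn !mulNr; congr (- _); exact: mulrC.
Qed.

Lemma nondecr_from0 f (df : R -> R) (r : R) :
  (forall s : R, `|s| < 1 -> is_derive s 1 f (df s)) ->
  (forall s, 0 < s < 1 -> 0 <= df s) -> 0 <= r < 1 -> f 0 <= f r.
Proof.
move=> D P /andP [r0 r1].
have [<-//|nz] := eqVneq 0 r.
have rp : 0 < r by rewrite lt_neqAle nz.
have [] := @MVT R f df 0 r rp.
- move=> s; rewrite in_itv /= => /andP[s0 sr]; apply: D.
  by rewrite gtr0_norm //; exact: lt_trans sr r1.
- apply: derivable_within_continuous => s; rewrite in_itv /= => /andP[s0 sr].
  by have [|//] := D s; rewrite ger0_norm //; exact: le_lt_trans sr r1.
move=> s; rewrite in_itv /= subr0 => /andP[s0 sr] e.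
by rewrite -subr_ge0 e mulr_ge0 // P // s0 (lt_trans sr r1).
Qed.

Lemma const_from0 f (df : R -> R) (r : R) :
  (forall s : R, `|s| < 1 -> is_derive s 1 f (df s)) ->
  (forall s, 0 < s < 1 -> df s = 0) -> 0 <= r < 1 -> f r = f 0.
Proof.
move=> D P hr; apply/eqP; rewrite eq_le (nondecr_from0 D) ?andbT //; last by move=> s /P ->.
rewrite -lerN2 -[X in X <= _]mulN1r -[X in _ <= X]mulN1r.
apply: (@nondecr_from0 (fun s => -1 * f s) (fun s => -1 * df s)) => // s.
  by move=> /D; exact: derZ.
by move=> /P ->; rewrite mulr0.
Qed.

End RealCalculus.

Section MeanLinear.
Context {R : realType} {n : nat}.
Hypothesis n1 : (1 < n)%N.

Lemma sphere_mean_lin3 (a b c : R) (f g h : 'rV[R]_n -> R) :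
  bounded_ball f -> bounded_ball g -> bounded_ball h ->
  sphere_mean (fun x => a * f x + b * g x + c * h x) =
  a * sphere_mean f + b * sphere_mean g + c * sphere_mean h.
Proof.
move=> bf bg bh.
have bm (d : R) (k : 'rV[R]_n -> R) : bounded_ball k -> bounded_ball (fun x => d * k x).
  by move=> bk; exact: bounded_ballM (bounded_ball_cst d) bk.
have b1 := bounded_ballD (bm a _ bf) (bm b _ bg).
rewrite sphere_meanD //; last exact: bm.
rewrite sphere_meanD //; try exact: bm.
by rewrite !sphere_meanZ.
Qed.

Lemma sphere_mean_lin4 (a b c d : R) (f g h k : 'rV[R]_n -> R) :
  bounded_ball f -> bounded_ball g -> bounded_ball h -> bounded_ball k ->
  sphere_mean (fun x => a * f x + b * g x + c * h x + d * k x) =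
  a * sphere_mean f + b * sphere_mean g + c * sphere_mean h + d * sphere_mean k.
Proof.
move=> bf bg bh bk.
have bm (e : R) (l : 'rV[R]_n -> R) : bounded_ball l -> bounded_ball (fun x => e * l x).
  by move=> bl; exact: bounded_ballM (bounded_ball_cst e) bl.
have b1 := bounded_ballD (bounded_ballD (bm a _ bf) (bm b _ bg)) (bm c _ bh).
rewrite sphere_meanD //; last exact: bm.
by rewrite sphere_mean_lin3 // sphere_meanZ.
Qed.

Lemma bounded_ball_sum (r : R) (f om : 'I_n -> 'rV[R]_n -> R) : `|r| < 1 ->
  (forall k y, ballr 1 y -> cont_at (f k) y) -> (forall k, bounded_ball (om k)) ->
  bounded_ball (fun x => \sum_k f k (r *: x) * om k x).
Proof.
move=> r1 cf bo; apply: (sphere_mean_sum _ _ _).1 => // k.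
by apply: bounded_ballM => //; apply: bounded_ball_dilate => //; exact: cf.
Qed.

Lemma sphere_mean_deriv_sum (f om : 'I_n -> 'rV[R]_n -> R) p (r : R) :
  (forall k, C1on (ballr 1) (f k) (p k)) -> (forall k, bounded_ball (om k)) -> `|r| < 1 ->
  is_derive r 1 (fun s => sphere_mean (fun x => \sum_k f k (s *: x) * om k x))
    (sphere_mean (fun x => \sum_k (\sum_i p k i (r *: x) * x 0 i) * om k x)).
Proof.
move=> F bo r1.
have cf k y : ballr 1 y -> cont_at (f k) y by move=> Ay; have [] := F k y Ay.
have bs k (s : R) : `|s| < 1 -> bounded_ball (fun x => f k (s *: x) * om k x).
  by move=> s1; apply: bounded_ballM => //; apply: bounded_ball_dilate => //; exact: cf.
have bp k : bounded_ball (fun x => (\sum_i p k i (r *: x) * x 0 i) * om k x).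
  apply: bounded_ballM => //; apply: bounded_ball_sum => //; last exact: coord_bounded.
  by move=> i y Ay; have [_ /(_ i) []] := F k y Ay.
have near1 : \forall s \near r, `|s| < 1.
  have o : open [set s : R | `|s| < 1].
    by apply: (@open_comp _ _ (fun s : R => `|s|) [set t | t < 1]); [move=> *; exact: norm_continuous|exact: open_lt].
  exact: open_nbhs_nbhs.
have H := @is_derive_sum R R R n (fun k s => sphere_mean (fun x => f k (s *: x) * om k x)) r 1 _
  (fun k => sphere_mean_deriv n1 (F k) (bo k) r1).
rewrite (sphere_mean_sum n1 _ bp).2.
apply: near_eq_is_derive H.
apply: filterS near1 => s s1; rewrite (sphere_mean_sum n1 _ (fun k => bs k s s1)).2.
by rewrite fct_sumE.
Qed.

End MeanLinear.

(** * The gradient bound at the centre of the ball *)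

(** An upper bound for the mean of [(x . w) f] over the unit sphere, when
    [|f| <= 1] and [f] has mean [a]: apply [sphere_mean_abs] with [c = - a]. *)
Definition moment_bound {R : realType} (n : nat) (a : R) : R :=
  (1 - a ^+ 2) / 2 - (n%:R - 3) / n%:R * ((1 - `|a|) ^+ 2 / 8).

Lemma moment_bound_le {R : realType} (n : nat) (a : R) : (3 <= n)%N ->
  moment_bound n a <= (1 - a ^+ 2) / 2.
Proof.
move=> n3; have nR : (3 : R) <= n%:R by rewrite (ler_nat R 3).
rewrite /moment_bound lerBlDr lerDl mulr_ge0 // ?divr_ge0 ?sqr_ge0 //; lra.
Qed.

Lemma moment_bound_lt {R : realType} (n : nat) (a : R) : (4 <= n)%N -> `|a| < 1 ->
  moment_bound n a < (1 - a ^+ 2) / 2.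
Proof.
move=> n4 a1; have nR : (4 : R) <= n%:R by rewrite (ler_nat R 4).
rewrite /moment_bound ltrBlDr ltrDl mulr_gt0 // ?divr_gt0 //; try lra.
by rewrite exprn_gt0 // subr_gt0.
Qed.

Section Core.
Context {R : realType} {m : nat}.
Local Notation n := m.+3.
Variables (kap : R) (v : 'rV[R]_n -> R) (g : 'I_n -> 'rV[R]_n -> R)
  (H : 'I_n -> 'I_n -> 'rV[R]_n -> R) (w : 'rV[R]_n).
Hypothesis kap01 : 0 <= kap <= 1.
Hypothesis Cv : C1on (ballr 1) v g.
Hypothesis Cg : forall i, C1on (ballr 1) (g i) (H i).
Hypothesis pde : forall y, ballr 1 y ->
  (1 - kap * dot y y) * \sum_i H i i y + 2 * kap * (n%:R - 2) * \sum_i y 0 i * g i y = 0.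
Hypothesis w1 : dot w w = 1.

Let n1 : (1 < n)%N. Proof. by []. Qed.
Let n3 : (2 < n)%N. Proof. by []. Qed.

(* Means of [v] ([A]), of its moment along [w] ([M]) and of its derivative
   along [w] ([S]) over the sphere of radius [r]; the digits count derivatives
   with respect to [r].  [L] and [Lt] are the mean and the moment of the
   Laplacian. *)
Let A (r : R) := sphere_mean (fun x => v (r *: x) * 1).
Let A1 (r : R) := sphere_mean (fun x => \sum_k g k (r *: x) * x 0 k).
Let A2 (r : R) := sphere_mean (fun x => \sum_k (\sum_i H k i (r *: x) * x 0 i) * x 0 k).
Let L (r : R) := sphere_mean (fun x => \sum_k H k k (r *: x)).
Let M (r : R) := sphere_mean (fun x => v (r *: x) * dot x w).
Let M1 (r : R) := sphere_mean (fun x => \sum_k g k (r *: x) * (x 0 k * dot x w)).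
Let M2 (r : R) := sphere_mean (fun x => \sum_k (\sum_i H k i (r *: x) * x 0 i) * (x 0 k * dot x w)).
Let Lt (r : R) := sphere_mean (fun x => (\sum_k H k k (r *: x)) * dot x w).
Let S (r : R) := sphere_mean (fun x => \sum_k g k (r *: x) * w 0 k).
Let S1 (r : R) := sphere_mean (fun x => \sum_k (\sum_i H k i (r *: x) * x 0 i) * w 0 k).

Let bx k : bounded_ball (fun x : 'rV[R]_n => x 0 k). Proof. exact: coord_bounded. Qed.
Let bt : bounded_ball (fun x => dot x w). Proof. exact: dot_bounded. Qed.
Let bxt k : bounded_ball (fun x => x 0 k * dot x w). Proof. exact: bounded_ballM. Qed.
Let bw k : bounded_ball (fun _ : 'rV[R]_n => w 0 k). Proof. exact: bounded_ball_cst. Qed.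

Let cv y : ballr 1 y -> cont_at v y. Proof. by move=> Ay; have [] := Cv Ay. Qed.
Let cg k y : ballr 1 y -> cont_at (g k) y. Proof. by move=> Ay; have [] := Cg k Ay. Qed.
Let cH k i y : ballr 1 y -> cont_at (H k i) y.
Proof. by move=> Ay; have [_ /(_ i) []] := Cg k Ay. Qed.

Let bv (r : R) : `|r| < 1 -> bounded_ball (fun x => v (r *: x)).
Proof. by move=> r1; apply: bounded_ball_dilate. Qed.

Let bg (r : R) (om : 'I_n -> 'rV[R]_n -> R) : `|r| < 1 -> (forall k, bounded_ball (om k)) ->
  bounded_ball (fun x => \sum_k g k (r *: x) * om k x).
Proof. by move=> r1; apply: bounded_ball_sum. Qed.

Let bH (r : R) (om : 'I_n -> 'rV[R]_n -> R) : `|r| < 1 -> (forall k, bounded_ball (om k)) ->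
  bounded_ball (fun x => \sum_k (\sum_i H k i (r *: x) * x 0 i) * om k x).
Proof.
move=> r1 bo; apply: (sphere_mean_sum n1 _ _).1 => k.
by apply: bounded_ballM => //; apply: bounded_ball_sum => // i y; exact: cH.
Qed.

Let bL (r : R) : `|r| < 1 -> bounded_ball (fun x => \sum_k H k k (r *: x)).
Proof.
move=> r1; apply: (sphere_mean_sum n1 _ _).1 => k.
by apply: bounded_ball_dilate => // y; exact: cH.
Qed.

Let dA (r : R) : `|r| < 1 -> is_derive r 1 A (A1 r).
Proof.
move=> r1; have := sphere_mean_deriv n1 Cv (bounded_ball_cst 1) r1.
by move=> h; apply: (@is_derive_eq _ _ _ _ _ _ _ _ h); congr sphere_mean; apply/funext => x; rewrite mulr1.
Qed.

Let dA1 (r : R) : `|r| < 1 -> is_derive r 1 A1 (A2 r).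
Proof. by move=> r1; exact: sphere_mean_deriv_sum. Qed.

Let dM (r : R) : `|r| < 1 -> is_derive r 1 M (M1 r).
Proof.
move=> r1; have := sphere_mean_deriv n1 Cv bt r1.
move=> h; apply: (@is_derive_eq _ _ _ _ _ _ _ _ h); congr sphere_mean; apply/funext => x.
by rewrite mulr_suml; apply: eq_bigr => k _; rewrite mulrA.
Qed.

Let dM1 (r : R) : `|r| < 1 -> is_derive r 1 M1 (M2 r).
Proof. by move=> r1; exact: sphere_mean_deriv_sum. Qed.

Let dS (r : R) : `|r| < 1 -> is_derive r 1 S (S1 r).
Proof. by move=> r1; exact: (sphere_mean_deriv_sum n1 (om := fun k _ => w 0 k)). Qed.

(* the spherical divergence theorem for the field [grad v (r x)] *)
Let flux (r : R) : `|r| < 1 -> r * L r - r * A2 r - (n%:R - 1) * A1 r = 0.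
Proof.
move=> r1.
rewrite -[RHS](sphere_mean_div n1 (dilation_radius_gt1 r1) (fun i => C1on_dilate r1 (Cg i))).
rewrite -!mulNr -sphere_mean_lin3 //; [|exact: bL|exact: bH|exact: bg].
congr sphere_mean; apply/funext => x; congr (_ + _ + _).
- by rewrite mulr_sumr.
- rewrite mulNr mulr_sumr; congr (- _); apply: eq_bigr => i _.
  by rewrite mulr_suml mulr_sumr; apply: eq_bigr => j _; ring.
- by rewrite mulNr; congr (- (_ * _)); apply: eq_bigr => i _; exact: mulrC.
Qed.

(* the same for the field [(x . w) grad v (r x)] *)
Let flux_w (r : R) : `|r| < 1 -> S r + r * Lt r - r * M2 r - n%:R * M1 r = 0.
Proof.
move=> r1.
have C i := C1onM (C1on_dot (A := ballr (dilation_radius r)) w) (C1on_dilate r1 (Cg i)).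
rewrite -[RHS](sphere_mean_div n1 (dilation_radius_gt1 r1) C).
have bLt := bounded_ballM (bL r1) bt.
have -> : S r + r * Lt r - r * M2 r - n%:R * M1 r = 1 * S r + r * Lt r + - r * M2 r + - n%:R * M1 r.
  by rewrite mul1r !mulNr.
rewrite -sphere_mean_lin4 //; [|exact: bg|exact: bH|exact: bg].
congr sphere_mean; apply/funext => x.
have -> : \sum_i (w 0 i * g i (r *: x) + dot x w * (r * H i i (r *: x))) =
    \sum_k g k (r *: x) * w 0 k + r * ((\sum_k H k k (r *: x)) * dot x w).
  rewrite big_split /= mulr_suml mulr_sumr; congr (_ + _); apply: eq_bigr => i _; ring.
have -> : \sum_i \sum_j x 0 i * x 0 j * (w 0 j * g i (r *: x) + dot x w * (r * H i j (r *: x))) =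
    \sum_k g k (r *: x) * (x 0 k * dot x w) + r * \sum_k (\sum_i H k i (r *: x) * x 0 i) * (x 0 k * dot x w).
  rewrite mulr_sumr -big_split /=; apply: eq_bigr => i _.
  have -> : g i (r *: x) * (x 0 i * dot x w) = \sum_j (x 0 j * w 0 j) * (g i (r *: x) * x 0 i).
    by rewrite -mulr_suml -/(dot x w); ring.
  rewrite mulr_suml mulr_sumr -big_split /=.
  by apply: eq_bigr => j _; ring.
have -> : \sum_i x 0 i * (dot x w * g i (r *: x)) = \sum_k g k (r *: x) * (x 0 k * dot x w).
  by apply: eq_bigr => i _; ring.
ring.
Qed.

(* the same for the field [v (r x) w] *)
Let flux_v (r : R) : `|r| < 1 -> r * S r - r * M1 r - (n%:R - 1) * M r = 0.
Proof.
move=> r1.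
have C i := C1onM (C1on_cst (A := ballr (dilation_radius r)) (w 0 i)) (C1on_dilate r1 Cv).
rewrite -[RHS](sphere_mean_div n1 (dilation_radius_gt1 r1) C).
rewrite -!mulNr -sphere_mean_lin3 //; [|exact: bg|exact: bg|exact: bounded_ballM (bv r1) bt].
congr sphere_mean; apply/funext => x; congr (_ + _ + _).
- by rewrite mulr_sumr; apply: eq_bigr => i _; ring.
- rewrite mulNr mulr_sumr; congr (- _); rewrite exchange_big /=; apply: eq_bigr => i _.
  by rewrite /dot !mulr_sumr; apply: eq_bigr => j _; ring.
- rewrite mulNr; congr (- (_ * _)); rewrite /dot mulr_sumr; apply: eq_bigr => i _; ring.
Qed.

(* On the unit sphere [1 - k |r x|^2] is [1 - k r^2]: the last term, whose mean
   is zero, accounts for the difference. *)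
Let pde_dilate (r : R) x : `|r| < 1 -> dot x x <= 1 ->
  (1 - kap * r ^+ 2) * (\sum_k H k k (r *: x)) + 2 * kap * (n%:R - 2) * r * (\sum_k g k (r *: x) * x 0 k)
  + kap * r ^+ 2 * ((1 - dot x x) * \sum_k H k k (r *: x)) = 0.
Proof.
move=> r1 hx; rewrite -[RHS](pde (in_dilate r1 hx)) dotZl dotZr.
have -> : \sum_i (r *: x) 0 i * g i (r *: x) = r * \sum_k g k (r *: x) * x 0 k.
  by rewrite mulr_sumr; apply: eq_bigr => i _; rewrite mxE; ring.
ring.
Qed.

Let mean_pde (r : R) : `|r| < 1 -> (1 - kap * r ^+ 2) * L r + 2 * kap * (n%:R - 2) * r * A1 r = 0.
Proof.
move=> r1; have bl := bL r1.
have bs : bounded_ball (fun x : 'rV[R]_n => 1 - dot x x).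
  by exists 1 => x hx; have := dot_ge0 x; rewrite ler_norml; lra.
rewrite -[LHS]addr0 -[X in _ + X = _](mulr0 (kap * r ^+ 2)) -[X in _ + _ * X = _](sphere_mean_radius n1 bl).
rewrite -sphere_mean_lin3 //; [|exact: bg|exact: bounded_ballM].
rewrite -[RHS](sphere_mean_cst n1); apply: sphere_mean_eq => //; last by move=> x; exact: pde_dilate.
have bm c (k : 'rV[R]_n -> R) (bk : bounded_ball k) := bounded_ballM (bounded_ball_cst c) bk.
by apply: bounded_ballD; [apply: bounded_ballD|]; apply: bm => //; [exact: bg|exact: bounded_ballM].
Qed.

Let mean_pde_w (r : R) : `|r| < 1 -> (1 - kap * r ^+ 2) * Lt r + 2 * kap * (n%:R - 2) * r * M1 r = 0.
Proof.
move=> r1; have bl := bounded_ballM (bL r1) bt.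
have bs : bounded_ball (fun x : 'rV[R]_n => 1 - dot x x).
  by exists 1 => x hx; have := dot_ge0 x; rewrite ler_norml; lra.
rewrite -[LHS]addr0 -[X in _ + X = _](mulr0 (kap * r ^+ 2)) -[X in _ + _ * X = _](sphere_mean_radius n1 bl).
rewrite -sphere_mean_lin3 //; [|exact: bg|exact: bounded_ballM].
rewrite -[RHS](sphere_mean_cst n1); apply: sphere_mean_eq => //.
  have bm c (k : 'rV[R]_n -> R) (bk : bounded_ball k) := bounded_ballM (bounded_ball_cst c) bk.
  by apply: bounded_ballD; [apply: bounded_ballD|]; apply: bm => //; [exact: bg|exact: bounded_ballM].
move=> x hx; have e := pde_dilate r1 hx.
have -> : \sum_k g k (r *: x) * (x 0 k * dot x w) = (\sum_k g k (r *: x) * x 0 k) * dot x w.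
  by rewrite mulr_suml; apply: eq_bigr => i _; ring.
have := congr1 (fun z => z * dot x w) e; rewrite /= mul0r => e2; apply: etrans e2.
ring.
Qed.

Let e (r : R) := (1 - kap * r ^+ 2)^-1.

Let den_gt0 (r : R) : `|r| < 1 -> 0 < 1 - kap * r ^+ 2.
Proof.
move: kap01 => /andP [k0 k1]; rewrite ltr_norml => /andP[a b].
have h : r ^+ 2 < 1 by nra.
have := sqr_ge0 r; nra.
Qed.

Let de (r : R) : `|r| < 1 -> is_derive r 1 e (2 * kap * r * e r ^+ 2).
Proof.
move=> r1; have nz : 1 - kap * r ^+ 2 != 0 by rewrite gt_eqF // den_gt0.
have D := derV (derB (der_cst 1 r) (derZ kap (derX 1 (der_id r)))) nz.
by apply: (@is_derive_eq _ _ _ _ _ _ _ _ D); rewrite /e; ring.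
Qed.

Let nE : (n%:R : R) = m%:R + 3. Proof. by rewrite -natrD addn3. Qed.

Let m1E : (m.+1%:R : R) = m%:R + 1. Proof. by rewrite natr1. Qed.
Let m2E : (m.+2%:R : R) = m%:R + 2. Proof. by rewrite -natrD addn2. Qed.

Let small (r : R) : 0 < r < 1 -> `|r| < 1.
Proof. by move=> /andP [a b]; rewrite gtr0_norm. Qed.

(* [r^(n-1) (1 - k r^2)^(2-n) A1 r] is the flux of the divergence-free field
   [(1 - k |y|^2)^(2-n) grad v], hence constant, and it vanishes at [0]. *)
Let A1_0 (r : R) : 0 <= r < 1 -> 0 < r -> A1 r = 0.
Proof.
move=> hr r0.
pose Q s := A1 s * s ^+ m.+2 * e s ^+ m.+1.
pose dQ s := (A2 s * s ^+ m.+2 + A1 s * (m.+2%:R * s ^+ m.+1 * 1)) * e s ^+ m.+1 +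
  A1 s * s ^+ m.+2 * (m.+1%:R * e s ^+ m * (2 * kap * s * e s ^+ 2)).
have QD (s : R) : `|s| < 1 -> is_derive s 1 Q (dQ s).
  by move=> s1; apply: derM; [apply: derM; [exact: dA1|exact: derX (der_id s)]|apply: derX; exact: de].
have Q0 : Q r = Q 0.
  apply: (const_from0 QD) => // s hs; have s1 := small hs.
  have dn := den_gt0 s1.
  have f1 := flux s1; have p1 := mean_pde s1.
  have ee : (1 - kap * s ^+ 2) * e s = 1 by rewrite mulfV // gt_eqF.
  have l : L s = - (2 * kap * (n%:R - 2) * s * A1 s) * e s.
    have h : (1 - kap * s ^+ 2) * L s = - (2 * kap * (n%:R - 2) * s * A1 s) by lra.
    by rewrite -h mulrAC ee mul1r.
  rewrite /dQ.
  have -> : (A2 s * s ^+ m.+2 + A1 s * (m.+2%:R * s ^+ m.+1 * 1)) * e s ^+ m.+1 +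
    A1 s * s ^+ m.+2 * (m.+1%:R * e s ^+ m * (2 * kap * s * e s ^+ 2)) =
    s ^+ m.+1 * e s ^+ m.+1 * (s * A2 s + m.+2%:R * A1 s + 2 * kap * m.+1%:R * s ^+ 2 * e s * A1 s).
    by rewrite !exprS; ring.
  have -> : s * A2 s = s * L s - (n%:R - 1) * A1 s by lra.
  by rewrite l nE m1E m2E; ring.
have : Q r = 0 by rewrite Q0 /Q expr0n /= mulr0 mul0r.
rewrite /Q => /eqP; rewrite mulf_eq0 mulf_eq0 => /orP [/orP [/eqP //|]|].
  by rewrite expf_eq0 /= (gt_eqF r0).
rewrite expf_eq0 /= invr_eq0 gt_eqF // den_gt0 //; apply: small; rewrite r0.
by case/andP: hr.
Qed.

Let mean_value (r : R) : 0 <= r < 1 -> A r = v 0.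
Proof.
move=> hr; rewrite (const_from0 dA _ hr).
  rewrite /A -[RHS](sphere_mean_cst n1); congr sphere_mean; apply/funext => x.
  by rewrite scale0r mulr1.
by move=> s /andP [s0 s1]; apply: A1_0 => //; rewrite ltW.
Qed.

Let d := \sum_k g k 0 * w 0 k.

(* Differentiating [flux_v] and comparing with [flux_w]. *)
Let S1E (r : R) : 0 < r < 1 -> S1 r = Lt r.
Proof.
move=> hr; have r1 := small hr; have r0 : r != 0 by rewrite gt_eqF //; case/andP: hr.
have D := derB (derB (derM (der_id r) (dS r1)) (derM (der_id r) (dM1 r1))) (derZ (n%:R - 1) (dM r1)).
have near1 : \forall s \near r, (fun=> 0) s = s * S s - s * M1 s - (n%:R - 1) * M s.
  have o : open [set s : R | `|s| < 1].
    by apply: (@open_comp _ _ (fun s : R => `|s|) [set t | t < 1]); [move=> *; exact: norm_continuous|exact: open_lt].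
  have : nbhs r [set s : R | `|s| < 1] by exact: open_nbhs_nbhs.
  by apply: filterS => s s1; rewrite flux_v.
have := near_eq_is_derive near1 (der_cst 0 r) => Z.
have E : 1 * S r + r * S1 r - (1 * M1 r + r * M2 r) - (n%:R - 1) * M1 r = 0.
  by case: D => _ <-; case: Z => _ <-.
apply: (mulfI r0); have := flux_w r1; move: E; rewrite !mul1r; lra.
Qed.

(* The left-hand side is the mean of the derivative of [v] along the field
   [(1 + k |y|^2) w - 2 k (y . w) y], an infinitesimal isometry (a translation
   for [k = 0], a hyperbolic translation for [k = 1]).  Such a derivative solves
   the same equation as [v], so its means do not depend on the radius. *)
Let killing (r : R) : 0 <= r < 1 -> (1 + kap * r ^+ 2) * S r - 2 * kap * r ^+ 2 * M1 r = d.
Proof.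
move=> hr.
pose W s := (1 + kap * s ^+ 2) * S s - 2 * kap * s ^+ 2 * M1 s.
pose dW s := ((0 + kap * (2%:R * s ^+ 1 * 1)) * S s + (1 + kap * s ^+ 2) * S1 s) -
   ((2 * kap * (2%:R * s ^+ 1 * 1)) * M1 s + 2 * kap * s ^+ 2 * M2 s).
have WD (s : R) : `|s| < 1 -> is_derive s 1 W (dW s).
  move=> s1; apply: derB; apply: derM; try exact: dS; try exact: dM1.
    exact: (derD (der_cst 1 s) (derZ kap (derX 1 (der_id s)))).
  by apply: derZ; exact: derX (der_id s).
rewrite -/(W r) (const_from0 WD _ hr).
  rewrite /W expr0n /= !mulr0 mul0r subr0 addr0 mul1r /S -[RHS](sphere_mean_cst n1).
  congr sphere_mean; apply/funext => x; rewrite /d; apply: eq_bigr => k _; by rewrite scale0r.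
move=> s hs; have s1 := small hs.
have p := mean_pde_w s1; have f := flux_w s1.
rewrite /dW (S1E hs) -[RHS]p.
have -> : 2 * kap * s ^+ 2 * M2 s = 2 * kap * s * (s * M2 s) by ring.
have -> : s * M2 s = S s + s * Lt s - n%:R * M1 s by lra.
by rewrite expr1; ring.
Qed.

(* By [killing] and [flux_v], [M] solves
     [(1 - k r^2) r M' + (n - 1) (1 + k r^2) M = d r],
   and [d r / N] with [N = n + k (n - 2)] is a subsolution for [d >= 0], the
   inequality being an equality at [r = 1].  The integrating factor of the equation is
   [r^(n-1) (1 - k r^2)^(1-n)]. *)
Let moment_ge (r : R) : 0 <= d -> 0 <= r < 1 -> d * r / (n%:R + kap * (n%:R - 2)) <= M r.
Proof.
move=> d0 hr; have /andP [r0 rl] := hr.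
have /andP [k0 k1] := kap01.
set N := n%:R + _.
have nR : (3 : R) <= n%:R by rewrite (ler_nat R 3).
have N0 : 0 < N by rewrite /N; nra.
have [<-|rn] := eqVneq 0 r.
  rewrite mulr0 mul0r /M le_eqVlt; apply/orP; left; apply/eqP.
  rewrite (_ : (fun x => _) = (fun x => v 0 * dot x w)); last by apply/funext => x; rewrite scale0r.
  by rewrite sphere_meanZ // sphere_mean_dot // mulr0.
have rp : 0 < r by rewrite lt_neqAle rn.
pose Y s := M s - (d / N) * s.
pose T s := Y s * s ^+ m.+2 * e s ^+ m.+2.
pose dT s := ((M1 s - (d / N) * 1) * s ^+ m.+2 + Y s * (m.+2%:R * s ^+ m.+1 * 1)) * e s ^+ m.+2 +
  Y s * s ^+ m.+2 * (m.+2%:R * e s ^+ m.+1 * (2 * kap * s * e s ^+ 2)).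
have TD (s : R) : `|s| < 1 -> is_derive s 1 T (dT s).
  move=> s1; apply: derM; last by apply: derX; exact: de.
  apply: derM; last exact: derX (der_id s).
  exact: (derB (dM s1) (derZ (d / N) (der_id s))).
have T0 : T 0 <= T r.
  apply: (nondecr_from0 TD) => // s hs; have s1 := small hs.
  have /andP [s0 sl] := hs.
  have dn := den_gt0 s1.
  have ee : (1 - kap * s ^+ 2) * e s = 1 by rewrite mulfV // gt_eqF.
  have e0 : 0 < e s by rewrite invr_gt0.
  have -> : dT s = s ^+ m.+1 * e s ^+ m.+3 *
     ((1 - kap * s ^+ 2) * s * (M1 s - d / N) + (n%:R - 1) * (1 + kap * s ^+ 2) * Y s).
    rewrite /dT.
    have -> : ((M1 s - d / N * 1) * s ^+ m.+2 + Y s * (m.+2%:R * s ^+ m.+1 * 1)) * e s ^+ m.+2 =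
       ((M1 s - d / N * 1) * s ^+ m.+2 + Y s * (m.+2%:R * s ^+ m.+1 * 1)) * e s ^+ m.+2 * ((1 - kap * s ^+ 2) * e s).
      by rewrite ee [RHS]mulr1.
    by rewrite nE m2E !exprS; ring.
  apply: mulr_ge0; first by rewrite mulr_ge0 // exprn_ge0 // ltW.
  have hs' : 0 <= s < 1 by rewrite ltW.
  have K := killing hs'; have f := flux_v s1.
  have -> : (1 - kap * s ^+ 2) * s * (M1 s - d / N) + (n%:R - 1) * (1 + kap * s ^+ 2) * Y s =
     s * d * ((kap * (n%:R - 2) * (1 - s ^+ 2)) / N).
    have -> : (1 - kap * s ^+ 2) * s * (M1 s - d / N) + (n%:R - 1) * (1 + kap * s ^+ 2) * Y s =
       (1 - kap * s ^+ 2) * s * M1 s + (1 + kap * s ^+ 2) * ((n%:R - 1) * M s) - s * d / N * ((1 - kap * s ^+ 2) + (n%:R - 1) * (1 + kap * s ^+ 2)).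
      by rewrite /Y; ring.
    have -> : (n%:R - 1) * M s = s * S s - s * M1 s by lra.
    have -> : (1 - kap * s ^+ 2) * s * M1 s + (1 + kap * s ^+ 2) * (s * S s - s * M1 s) = s * d.
      by rewrite -K; ring.
    have NN : N != 0 by rewrite gt_eqF.
    have -> : s * d - s * d / N * (1 - kap * s ^+ 2 + (n%:R - 1) * (1 + kap * s ^+ 2)) =
      s * d * ((N - (1 - kap * s ^+ 2 + (n%:R - 1) * (1 + kap * s ^+ 2))) / N) by field.
    by congr (_ * (_ / _)); rewrite /N; ring.
  have : s ^+ 2 <= 1 by nra.
  move=> s2; rewrite mulr_ge0 //; first by rewrite mulr_ge0 // ltW.
  by apply: divr_ge0; [apply: mulr_ge0; [apply: mulr_ge0|]|]; lra.
move: T0; rewrite /T expr0n /= mulr0 mul0r -mulrA pmulr_lge0.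
  by rewrite /Y subr_ge0 mulrAC.
have r1 : `|r| < 1 by rewrite ger0_norm.
by rewrite mulr_gt0 // exprn_gt0 // invr_gt0 den_gt0.
Qed.

Lemma gradient_bound_centre : (forall y, ballr 1 y -> `|v y| <= 1) -> `|v 0| < 1 ->
  \sum_k g k 0 * w 0 k <= (n%:R + kap * (n%:R - 2)) * moment_bound n (v 0).
Proof.
move=> vb a1; rewrite -/d /moment_bound; set a := v 0; set B := (1 - a ^+ 2) / 2 - _.
have /andP [k0 k1] := kap01.
have nR : (3 : R) <= n%:R by rewrite (ler_nat R 3).
set N := n%:R + _.
have N0 : 0 < N by rewrite /N; nra.
have step (r : R) : 0 <= d -> 0 <= r < 1 -> d * r <= N * B.
  move=> d0 hr; have r1 : `|r| < 1 by have /andP [r0 ?] := hr; rewrite ger0_norm.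
  have := moment_ge d0 hr; rewrite -/N ler_pdivrMr // => /le_trans; apply.
  rewrite mulrC ler_pM2l //.
  have bv1 := bv r1.
  have -> : M r = sphere_mean (fun x => v (r *: x) * dot x w + a * (v (r *: x) * 1)) + - a * A r.
    rewrite sphere_meanD //; last 2 first.
    - exact: bounded_ballM.
    - by apply: bounded_ballM; [exact: bounded_ball_cst|apply: bounded_ballM => //; exact: bounded_ball_cst].
    rewrite sphere_meanZ //; last by apply: bounded_ballM => //; exact: bounded_ball_cst.
    by rewrite -/(A r) -/(M r); ring.
  rewrite mean_value //.
  have na : `|- a| < 1 by rewrite normrN.
  have := sphere_mean_abs n3 w1 na; rewrite normrN sqrrN opprK.
  set E := sphere_mean _ => hE.
  have : sphere_mean (fun x => v (r *: x) * dot x w + a * (v (r *: x) * 1)) <= E.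
    have bta : bounded_ball (fun x => dot x w + a) by apply: bounded_ballD => //; exact: bounded_ball_cst.
    apply: sphere_mean_le => //.
    - apply: bounded_ballD; first exact: bounded_ballM.
      by apply: bounded_ballM; [exact: bounded_ball_cst|apply: bounded_ballM => //; exact: bounded_ball_cst].
    - by have [K hK] := bta; exists K => x /hK; rewrite normr_id.
    move=> x hx; have h := vb _ (in_dilate r1 hx).
    rewrite (_ : v (r *: x) * dot x w + a * (v (r *: x) * 1) = v (r *: x) * (dot x w + a)); last by ring.
    apply: le_trans (ler_norm _) _; rewrite normrM -[X in _ <= X]mul1r.
    exact: ler_wpM2r.
  rewrite /B -/a; move: hE; set G := _ * (_ / 8); set X := sphere_mean _; rewrite !expr2; lra.
(* needed when the derivative is negative, and to let [r] tend to 1 *)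
have B0 : 0 <= B.
  have n0' : 0 < n%:R :> R by lra.
  have q : (n%:R - 3) / n%:R <= 1 :> R by rewrite ler_pdivrMr //; lra.
  have q0 : 0 <= (n%:R - 3) / n%:R :> R by rewrite divr_ge0 //; lra.
  have aa : a ^+ 2 = `|a| ^+ 2 by rewrite real_normK // num_real.
  rewrite /B -/a aa; move: ((n%:R - 3) / n%:R) q q0 => q q1 q0.
  have a0 : 0 <= `|a| by []. have a1' : `|a| < 1 by [].
  move: (`|a|) a0 a1' => b b0 b1; have : 0 <= (1 - b) ^+ 2 / 8 by rewrite divr_ge0 // sqr_ge0.
  nra.
have [dpos|dneg] := leP 0 d; last by apply: le_trans (ltW dneg) _; rewrite mulr_ge0 // ltW.
have NB0 : 0 <= N * B by rewrite mulr_ge0 // ltW.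
rewrite leNgt; apply/negP => lt.
have dp : 0 < d by exact: le_lt_trans NB0 lt.
have hr : 0 <= (1 + N * B / d) / 2 < 1.
  have h1 : 0 <= N * B / d by rewrite divr_ge0.
  have h2 : N * B / d < 1 by rewrite ltr_pdivrMr // mul1r.
  by apply/andP; split; lra.
have := step _ dpos hr.
have -> : d * ((1 + N * B / d) / 2) = (d + N * B) / 2 by field; rewrite gt_eqF.
lra.
Qed.

End Core.

(** * Moving an arbitrary point to the centre *)

Section Conformal.
Context {R : realType} {m : nat}.
Local Notation n := m.+3.
Variables (kap : R) (u : 'rV[R]_n -> R) (g : 'I_n -> 'rV[R]_n -> R)
  (H : 'I_n -> 'I_n -> 'rV[R]_n -> R).
Hypothesis Cu : C1on (ballr 1) u g.
Hypothesis Cg : forall i, C1on (ballr 1) (g i) (H i).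
Hypothesis ub : forall y, ballr 1 y -> `|u y| <= 1.

(** Under a conformal map the Laplacian of [u] is multiplied by the square
    [lam] of the conformal factor, and only the Laplacians of the components of
    [phi] produce first-order terms.  The last
    hypothesis on [phi] is thus the equation of parameter [kap] for the
    composite of [u] with [phi]. *)
Lemma gradient_bound_conformal (phi : 'rV[R]_n -> 'rV[R]_n)
    (q : 'I_n -> 'I_n -> 'rV[R]_n -> R) (qq : 'I_n -> 'I_n -> 'I_n -> 'rV[R]_n -> R)
    (lam : 'rV[R]_n -> R) (w : 'rV[R]_n) :
  0 <= kap <= 1 ->
  (forall y, ballr 1 y -> ballr 1 (phi y)) ->
  (forall k, C1on (ballr 1) (fun y => phi y 0 k) (q k)) ->
  (forall k i, C1on (ballr 1) (q k i) (qq k i)) ->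
  (forall y k l, ballr 1 y -> \sum_i q l i y * q k i y = (l == k)%:R * lam y) ->
  (forall y, ballr 1 y ->
    (1 - kap * dot y y) * (lam y * \sum_k H k k (phi y) + \sum_k g k (phi y) * \sum_i qq k i i y)
    + 2 * kap * (n%:R - 2) * \sum_k g k (phi y) * (\sum_i y 0 i * q k i y) = 0) ->
  dot w w = 1 -> `|u (phi 0)| < 1 ->
  \sum_k g k (phi 0) * (\sum_i q k i 0 * w 0 i) <= (n%:R + kap * (n%:R - 2)) * moment_bound n (u (phi 0)).
Proof.
move=> k01 ball Cphi Cq conf pde w1 u1.
have Cv := C1on_comp (@ballr_open R n 1) Cu ball Cphi.
have Cgv i := C1on_sum (index_enum 'I_n) (fun k =>
  C1onM (C1on_comp (@ballr_open R n 1) (Cg k) ball Cphi) (Cq k i)).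
have := @gradient_bound_centre R m kap (fun y => u (phi y)) _ _ w k01 Cv Cgv.
move=> /(_ _ w1) B.
have -> : \sum_k g k (phi 0) * (\sum_i q k i 0 * w 0 i) =
    \sum_i (\sum_k g k (phi 0) * q k i 0) * w 0 i.
  under eq_bigr do rewrite mulr_sumr.
  rewrite exchange_big /=; apply: eq_bigr => i _; rewrite mulr_suml.
  by apply: eq_bigr => k _; rewrite mulrA.
apply: B => //; last by move=> y /ball; exact: ub.
move=> y Ay; rewrite -[RHS](pde y Ay); congr (_ * _ + _ * _); last first.
  under eq_bigr do rewrite mulr_sumr.
  rewrite exchange_big /=; apply: eq_bigr => i _; rewrite mulr_sumr.
  by apply: eq_bigr => k _; ring.
rewrite exchange_big /= mulr_sumr -big_split /=; apply: eq_bigr => k _.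
rewrite big_split /= mulr_sumr; congr (_ + _).
under eq_bigr do rewrite mulr_suml.
rewrite exchange_big /= (bigD1 k) //= [X in _ + X]big1 ?addr0.
  under eq_bigr do rewrite -mulrA.
  by rewrite -mulr_sumr conf // eqxx mul1r mulrC.
move=> l /negbTE lk; under eq_bigr do rewrite -mulrA.
by rewrite -mulr_sumr conf // lk mul0r mulr0.
Qed.

End Conformal.

Section Models.
Context {R : realType} {m : nat}.
Local Notation n := m.+3.

Variables (u : 'rV[R]_n -> R) (g : 'I_n -> 'rV[R]_n -> R)
  (H : 'I_n -> 'I_n -> 'rV[R]_n -> R).
Hypothesis Cu : C1on (ballr 1) u g.
Hypothesis Cg : forall i, C1on (ballr 1) (g i) (H i).
Hypothesis ub : forall y, ballr 1 y -> `|u y| <= 1.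

Lemma gradient_bound_harmonic (x w : 'rV[R]_n) :
  (forall y, ballr 1 y -> \sum_k H k k y = 0) -> ballr 1 x -> dot w w = 1 -> `|u x| < 1 ->
  \sum_k g k x * w 0 k <= n%:R * moment_bound n (u x) / (1 - enorm x).
Proof.
move=> lap Ax w1 u1.
set e := enorm x; have e0 : 0 <= e := enorm_ge0 x.
have ee : e ^+ 2 = dot x x := enorm_sqr x.
have e1 : e < 1 by have := eballE x; move=> [_]; apply.
set rho := 1 - e; have r0 : 0 < rho by rewrite subr_gt0.
pose phi (y : 'rV[R]_n) := x + rho *: y.
have phi0 : phi 0 = x by rewrite /phi scaler0 addr0.
have ball y : ballr 1 y -> ballr 1 (phi y).
  move=> Ay; have s1 : enorm y < 1 by have := eballE y; move=> [_]; apply.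
  have s0 := enorm_ge0 y; have ss := enorm_sqr y; have cs := dot_CS x y.
  rewrite /ballr /= /phi !(dotDl, dotDr, dotZl, dotZr) (dotC y x) -ee -ss.
  rewrite -ee -ss in cs; move: (enorm y) (dot x y) s1 s0 cs => s p s1 s0 cs.
  have hp : p <= e * s.
    have es : 0 <= e * s by rewrite mulr_ge0.
    rewrite leNgt; apply/negP => lt.
    have h : (e * s) ^+ 2 < p ^+ 2 by rewrite ltrXn2r // ltW // (le_lt_trans es lt).
    by move: h; rewrite exprMn ltNge cs.
  have : (e + rho * s) ^+ 2 < 1.
    have h1 : e + rho * s < 1 by rewrite /rho; nra.
    have h0 : 0 <= e + rho * s by rewrite addr_ge0 // mulr_ge0 // ltW.
    by nra.
  have : rho * p <= rho * (e * s) by rewrite ler_pM2l.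
  rewrite !expr2; nra.
have Q k : C1on (ballr 1) (fun y => phi y 0 k) (fun i _ => rho * (k == i)%:R).
  refine (C1on_ext (C1onD (C1on_cst (A := ballr 1) (x 0 k)) (C1onM (C1on_cst (A := ballr 1) rho) (C1on_coord (A := ballr 1) k))) _ _).
    by move=> y; rewrite !mxE.
  by move=> i y; ring.
have QQ (k i : 'I_n) : C1on (ballr 1) (fun _ : 'rV[R]_n => rho * (k == i)%:R) (fun _ _ => 0) := C1on_cst _.
have B := @gradient_bound_conformal R m 0 u g H Cu Cg ub phi _ (fun _ _ _ _ => 0) (fun=> rho ^+ 2) w _ ball Q QQ.
have delta (f : 'I_n -> R) k : \sum_i rho * (k == i)%:R * f i = rho * f k.
  rewrite (bigD1 k) //= eqxx mulr1 big1 ?addr0 // => i; rewrite eq_sym => /negbTE ->.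
  by rewrite mulr0 mul0r.
rewrite phi0 in B; rewrite -/e -/rho ler_pdivlMr //.
have {B} := B _ _ _ w1 u1.
rewrite mul0r addr0 => B; apply: le_trans (B _ _ _).
- rewrite le_eqVlt; apply/orP; left; apply/eqP; rewrite mulr_suml; apply: eq_bigr => k _.
  by rewrite delta; ring.
- by rewrite lexx ler01.
- move=> y k l _; rewrite delta; case: eqP => [->|nk]; first by rewrite eqxx; ring.
  by rewrite eq_sym (negbTE (introN eqP _)) //; ring.
- move=> y /ball Ay.
  have Z : \sum_k g k (phi y) * \sum_(i < n) 0 = 0.
    by apply: big1 => k _; rewrite big1 // mulr0.
  by rewrite lap // Z; ring.
Qed.

(** Inversion in the sphere centred at [b] that is orthogonal to the unit
    sphere: it preserves the unit ball and exchanges [0] and [b / |b|^2]. *)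
Section Inversion.
Variable b : 'rV[R]_n.
Hypothesis bb1 : 1 < dot b b.

Let rho := dot b b - 1.
Let z (y : 'rV[R]_n) := y + (-1) *: b.
Let iv (y : 'rV[R]_n) := (dot (z y) (z y))^-1.

Definition inversion y := b + (rho * iv y) *: z y.

(* first and second partial derivatives of [inversion]; the factor [rho * iv y]
   is the conformal factor *)
Let qi k i y := rho * ((k == i)%:R * iv y + - 2 * z y 0 i * z y 0 k * (iv y * iv y)).
Let qqi k i j y := rho * ((k == i)%:R * (- 2 * z y 0 j * (iv y * iv y))
  + - 2 * ((i == j)%:R * z y 0 k + z y 0 i * (k == j)%:R) * (iv y * iv y)
  + 8 * z y 0 i * z y 0 k * z y 0 j * (iv y * iv y * iv y)).

Let zz y : dot (z y) (z y) = dot y y - 2 * dot y b + dot b b.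
Proof. by rewrite /z !(dotDl, dotDr, dotZl, dotZr) (dotC b y); ring. Qed.

Let yz y : dot y (z y) = dot y y - dot y b.
Proof. by rewrite /z dotDr dotZr; ring. Qed.

Let bz y : dot b (z y) = dot y b - dot b b.
Proof. by rewrite /z dotDr dotZr (dotC b y); ring. Qed.

Let zz0 y : ballr 1 y -> 0 < dot (z y) (z y).
Proof.
rewrite /ballr /= => s1; have := dot_ge0 (z y); rewrite le_eqVlt => /predU1P [|//].
move=> e; have := dot_CS y b; have := bb1; move: e; rewrite zz.
move: (dot y y) (dot y b) (dot b b) s1 => s p B s1 e B1 cs.
have pe : p = (s + B) / 2 by lra.
by rewrite pe in cs; nra.
Qed.

Let ivz y : ballr 1 y -> iv y * dot (z y) (z y) = 1.
Proof. by move=> Ay; rewrite mulVf // gt_eqF // zz0. Qed.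

Let Cz k : C1on (ballr 1) (fun y => z y 0 k) (fun i _ => (k == i)%:R).
Proof.
refine (C1on_ext (C1onD (C1on_coord (A := ballr 1) k) (C1on_cst (A := ballr 1) (((-1) *: b) 0 k))) _ _).
  by move=> y; rewrite [RHS]mxE.
by move=> i y; rewrite addr0.
Qed.

Let Civ : C1on (ballr 1) iv (fun i y => - 2 * z y 0 i * (iv y * iv y)).
Proof.
have nz y : ballr 1 y -> dot (z y) (z y) != 0 by move=> Ay; rewrite gt_eqF // zz0.
have D : C1on (ballr 1) (fun y => dot (z y) (z y)) (fun i y => 2 * z y 0 i).
  refine (C1on_ext (C1on_sum (index_enum 'I_n) (fun k => C1onM (Cz k) (Cz k))) _ _) => // i y.
  rewrite (bigD1 i) //= eqxx big1 ?addr0; first by rewrite /=; ring.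
  by move=> j /negbTE -> /=; ring.
refine (C1on_ext (C1onV D nz) _ _) => // i y; rewrite /iv; ring.
Qed.

Lemma inversion_C1 k : C1on (ballr 1) (fun y => inversion y 0 k) (qi k).
Proof.
refine (C1on_ext (C1onD (C1on_cst (A := ballr 1) (b 0 k))
  (C1onM (C1onM (C1on_cst (A := ballr 1) rho) Civ) (Cz k))) _ _).
  by move=> y; rewrite /inversion !mxE.
by move=> i y; rewrite /qi; ring.
Qed.

Lemma inversion_C2 k i : C1on (ballr 1) (qi k i) (qqi k i).
Proof.
refine (C1on_ext (C1onM (C1on_cst (A := ballr 1) rho)
  (C1onD (C1onM (C1on_cst (A := ballr 1) (k == i)%:R) Civ)
    (C1onM (C1onM (C1onM (C1on_cst (A := ballr 1) (- 2)) (Cz i)) (Cz k)) (C1onM Civ Civ)))) _ _) => //.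
by move=> j y; rewrite /qqi; ring.
Qed.

Lemma inversion_ball y : ballr 1 y ->
  1 - dot (inversion y) (inversion y) = rho * iv y * (1 - dot y y).
Proof.
move=> Ay; have iz := ivz Ay.
have e := zz y; have f := bz y.
rewrite /inversion; move: (z y) (iv y) iz e f => Z J iz e f.
rewrite !(dotDl, dotDr, dotZl, dotZr) (dotC Z b) f.
have -> : rho * J * (rho * J * dot Z Z) = rho * J * rho * (J * dot Z Z) by ring.
rewrite iz mulr1.
have -> : rho * J * (1 - dot y y) = rho * J * (1 - dot y y) + rho * (J * dot Z Z - 1) by rewrite iz; ring.
by rewrite e /rho; ring.
Qed.

Lemma inversion0 : inversion 0 = (dot b b)^-1 *: b.
Proof.
have bn : dot b b != 0 by rewrite gt_eqF // (lt_trans ltr01).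
apply/rowP => k; rewrite /inversion /iv zz.
have -> : dot (0 : 'rV[R]_n) 0 - 2 * dot 0 b + dot b b = dot b b.
  by rewrite !dot0l; ring.
by rewrite !mxE /rho; field.
Qed.

Let delta (f : 'I_n -> R) k : \sum_i (k == i)%:R * f i = f k.
Proof.
rewrite (bigD1 k) //= eqxx mul1r big1 ?addr0 // => i; rewrite eq_sym => /negbTE ->.
by rewrite mul0r.
Qed.

Let sum_qi k y (f : 'I_n -> R) : \sum_i qi k i y * f i =
  rho * iv y * (f k + - 2 * z y 0 k * iv y * \sum_i z y 0 i * f i).
Proof.
rewrite /qi (eq_bigr (fun i => rho * iv y * ((k == i)%:R * f i) + - 2 * rho * z y 0 k * (iv y * iv y) * (z y 0 i * f i))).
  by rewrite big_split /= -!mulr_sumr delta; ring.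
by move=> i _; ring.
Qed.

Lemma inversion_conformal y k l : ballr 1 y ->
  \sum_i qi l i y * qi k i y = (l == k)%:R * (rho * iv y) ^+ 2.
Proof.
move=> Ay; have iz := ivz Ay.
rewrite sum_qi; under eq_bigr do rewrite mulrC.
rewrite sum_qi {1}/qi -/(dot (z y) (z y)) (eq_sym k l).
set D := dot (z y) (z y) in iz *.
have -> : rho * iv y * (z y 0 k + -2 * z y 0 k * iv y * D) = - rho * iv y * z y 0 k.
  have -> : -2 * z y 0 k * iv y * D = -2 * z y 0 k * (iv y * D) by ring.
  by rewrite iz; ring.
ring.
Qed.

Lemma inversion_laplacian y k : ballr 1 y ->
  \sum_i qqi k i i y = - 2 * (n%:R - 2) * rho * (iv y * iv y) * z y 0 k.
Proof.
move=> Ay; have iz := ivz Ay.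
rewrite /qqi (eq_bigr (fun i => - 4 * rho * (iv y * iv y) * ((k == i)%:R * z y 0 i)
    + (- 2 * rho * (iv y * iv y) * z y 0 k) + 8 * rho * (iv y * iv y * iv y) * z y 0 k * (z y 0 i * z y 0 i))).
  rewrite !big_split /= -!mulr_sumr delta sumr_const card_ord -/(dot (z y) (z y)).
  rewrite -[_ *+ n]mulr_natl.
  have -> : 8 * rho * (iv y * iv y * iv y) * z y 0 k * dot (z y) (z y) = 8 * rho * (iv y * iv y) * z y 0 k * (iv y * dot (z y) (z y)) by ring.
  by rewrite iz; ring.
move=> i _; rewrite eqxx; case: eqP => [<-|_] /=; ring.
Qed.

Lemma gradient_bound_inversion (w : 'rV[R]_n) :
  (forall y, ballr 1 y ->
     (1 - dot y y) * \sum_k H k k y + 2 * (n%:R - 2) * \sum_k y 0 k * g k y = 0) ->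
  dot w w = 1 -> `|u ((dot b b)^-1 *: b)| < 1 ->
  \sum_k g k ((dot b b)^-1 *: b) * w 0 k <=
  (n%:R + 1 * (n%:R - 2)) * moment_bound n (u ((dot b b)^-1 *: b)) / (1 - (dot b b)^-1).
Proof.
move=> pde w1 u1.
have r0 : 0 < rho by rewrite subr_gt0.
have bn : 0 < dot b b by exact: lt_trans bb1.
have iv0 y : ballr 1 y -> 0 < iv y by move=> Ay; rewrite invr_gt0 zz0.
have ball y : ballr 1 y -> ballr 1 (inversion y).
  move=> Ay; rewrite /ballr /= -subr_gt0 inversion_ball // mulr_gt0 ?subr_gt0 //.
  by rewrite mulr_gt0 // iv0.
(* The derivative of the inversion at [0] is a multiple of the reflection that
   reverses [b]; the image of [w] under this reflection is needed to reach the
   direction [w]. *)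
pose w' := w + (- 2 * (dot b b)^-1 * dot w b) *: b.
have w'b : dot b w' = - dot w b.
  by rewrite /w' dotDr dotZr (dotC b w); field; rewrite gt_eqF.
have w'1 : dot w' w' = 1.
  by rewrite {1}/w' dotDl dotZl w'b /w' dotDr dotZr w1; field; rewrite gt_eqF.
have B := @gradient_bound_conformal R m 1 u g H Cu Cg ub inversion qi qqi
  (fun y => (rho * iv y) ^+ 2) w' _ ball inversion_C1 inversion_C2.
have ball0 : ballr 1 (0 : 'rV[R]_n).
  by rewrite /ballr /= dot0l ltr01.
have z0 : z 0 = (-1) *: b by rewrite /z add0r.
have ivE : iv 0 = (dot b b)^-1.
  by rewrite /iv z0 dotZl dotZr; congr (_^-1); ring.
rewrite inversion0 in B.
have lamE : 1 - (dot b b)^-1 = rho * (dot b b)^-1 by rewrite /rho; field; rewrite gt_eqF.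
have lam0 : 0 < rho * (dot b b)^-1 by rewrite mulr_gt0 // invr_gt0.
rewrite lamE ler_pdivlMr //.
apply: le_trans (B _ _ _ w'1 u1).
- rewrite le_eqVlt; apply/orP; left; apply/eqP; rewrite mulr_suml; apply: eq_bigr => k _.
  rewrite sum_qi ivE z0 -/(dot ((-1) *: b) w') dotZl w'b /w' !mxE; ring.
- by rewrite ler01 lexx.
- by move=> y k l Ay; rewrite inversion_conformal.
move=> y Ay; have p := pde _ (ball y Ay); have iz := ivz Ay.
rewrite inversion_ball // in p.
have radial k : \sum_i y 0 i * qi k i y = rho * iv y * (y 0 k + - 2 * z y 0 k * iv y * dot y (z y)).
  under eq_bigr do rewrite mulrC.
  by rewrite sum_qi [dot y _]dotC.
have -> : \sum_k g k (inversion y) * \sum_i qqi k i i y =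
    \sum_k g k (inversion y) * (- 2 * (n%:R - 2) * rho * (iv y * iv y) * z y 0 k).
  by apply: eq_bigr => k _; rewrite inversion_laplacian.
have -> : \sum_k g k (inversion y) * (\sum_i y 0 i * qi k i y) =
    \sum_k g k (inversion y) * (rho * iv y * (y 0 k + - 2 * z y 0 k * iv y * dot y (z y))).
  by apply: eq_bigr => k _; rewrite radial.
have l0 : 0 < rho * iv y by rewrite mulr_gt0 // iv0.
have -> : (1 - 1 * dot y y) * ((rho * iv y) ^+ 2 * \sum_k H k k (inversion y) +
    \sum_k g k (inversion y) * (- 2 * (n%:R - 2) * rho * (iv y * iv y) * z y 0 k)) +
    2 * 1 * (n%:R - 2) * \sum_k g k (inversion y) * (rho * iv y * (y 0 k + - 2 * z y 0 k * iv y * dot y (z y))) =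
  rho * iv y * (rho * iv y * (1 - dot y y) * \sum_k H k k (inversion y) +
    2 * (n%:R - 2) * \sum_k inversion y 0 k * g k (inversion y)).
  rewrite [in RHS]mulrDr.
  have -> : rho * iv y * (2 * (n%:R - 2) * \sum_k inversion y 0 k * g k (inversion y)) =
    (1 - 1 * dot y y) * \sum_k g k (inversion y) * (- 2 * (n%:R - 2) * rho * (iv y * iv y) * z y 0 k) +
    2 * 1 * (n%:R - 2) * \sum_k g k (inversion y) * (rho * iv y * (y 0 k + - 2 * z y 0 k * iv y * dot y (z y))).
    rewrite [1 * dot y y]mul1r !mulr_sumr -big_split /=; apply: eq_bigr => k _.
    have iE : inversion y 0 k = b 0 k + rho * iv y * z y 0 k by rewrite /inversion !mxE.
    have bE : b 0 k = y 0 k - z y 0 k by rewrite /z !mxE; ring.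
    rewrite iE bE yz.
    have key : z y 0 k * (iv y * dot (z y) (z y) - 1) = 0 by rewrite iz subrr mulr0.
    rewrite zz in key.
    apply/eqP; rewrite -subr_eq0; apply/eqP.
    transitivity (2 * (n%:R - 2) * rho * iv y * g k (inversion y) *
      (z y 0 k * (iv y * (dot y y - 2 * dot y b + dot b b) - 1))); last by rewrite key mulr0.
    by rewrite /rho; ring.
  ring.
by rewrite p mulr0.
Qed.

End Inversion.

End Models.

(** * From components to the modulus of a vector-valued map *)

Section AbsGrad.
Context {R : realType} {n p : nat}.

Lemma enormE k (y : 'rV[R]_k) : enorm y = Num.sqrt (dot y y).
Proof. by rewrite /enorm; congr Num.sqrt; apply: eq_bigr => i _; rewrite expr2. Qed.

Lemma C1on_of_Ck (f : 'rV[R]_n -> R) : Ck_on 2 eball f ->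
  C1on (ballr 1) f (fun i => partial i f) /\
  forall i, C1on (ballr 1) (partial i f) (fun j => partial j (partial i f)).
Proof.
move=> [c0 /= h]; split=> [y|i y] /eballE Ay; split.
- exact: c0.
- move=> i; have [dr [ci _]] := h i; split; last exact: ci.
  exact/derivableP/dr.
- by have [_ [ci _]] := h i; exact: ci.
- move=> j; have [_ [_ hj]] := h i; have [dr [cj _]] := hj j; split; last exact: cj.
  exact/derivableP/dr.
Qed.

(** If [h x <> 0], the modulus of [h] is differentiable at [x] and its derivative
    is that of the component of [h] along [h x].  If [h x = 0], the one-sided
    derivative of the modulus in direction [w] is the norm of the derivative
    [D] of [h], that is, the derivative of the component of [h] along [D]; in
    this case every unit [e] satisfies the last premise of the hypothesis.
    Replacing [w] by [- w] takes care of the absolute value. *)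
Lemma abs_grad_norm_le (h : 'rV[R]_n -> 'rV[R]_p) (x : 'rV[R]_n) (C : R) :
  (0 < p)%N ->
  (forall j, C1on (ballr 1) (fun y => h y 0 j) (fun i => partial i (fun y => h y 0 j))) ->
  ballr 1 x ->
  (forall (e : 'rV[R]_p) (w : 'rV[R]_n), dot e e = 1 -> dot w w = 1 ->
     dot (h x) e = enorm (h x) ->
     \sum_k (\sum_j partial k (fun y => h y 0 j) x * e 0 j) * w 0 k <= C) ->
  (abs_grad_norm h x <= C%:E)%E.
Proof.
move=> p0 Ch Ax bound; apply: ge_ereal_sup => _ [w /esphereE w1 <-].
rewrite lee_fin.
pose D : 'rV[R]_p := \row_j \sum_k partial k (fun y => h y 0 j) x * w 0 k.
have dh j : is_derive x w (fun y => h y 0 j) (D 0 j).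
  by rewrite mxE; exact: (C1on_dir w (@ballr_open R n 1) (Ch j) Ax).
have De e : dot D e = \sum_k (\sum_j partial k (fun y => h y 0 j) x * e 0 j) * w 0 k.
  rewrite /dot; under eq_bigr do rewrite mxE mulr_suml.
  rewrite exchange_big /=; apply: eq_bigr => k _; rewrite mulr_suml.
  by apply: eq_bigr => j _; ring.
have boundD e : dot e e = 1 -> dot (h x) e = enorm (h x) -> `|dot D e| <= C.
  move=> e1 he; rewrite ler_norml; apply/andP; split; last by rewrite De bound.
  rewrite -lerN2 opprK.
  have w1' : dot (-1 *: w) (-1 *: w) = 1 by rewrite dotZl dotZr w1; ring.
  apply: le_trans (bound e (-1 *: w) e1 w1' he).
  rewrite De -sumrN le_eqVlt; apply/orP; left; apply/eqP; apply: eq_bigr => k _.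
  by rewrite mxE; ring.
have normalize (y : 'rV[R]_p) : enorm y != 0 ->
    dot ((enorm y)^-1 *: y) ((enorm y)^-1 *: y) = 1 /\ dot y ((enorm y)^-1 *: y) = enorm y.
  by move=> y0; rewrite dotZl !dotZr -enorm_sqr; split; field.
pose F t := enorm (h (x + t *: w)).
have F0 : F 0 = enorm (h x) by rewrite /F scale0r addr0.
suff [nu lim nuC] : exists2 nu, `|F t - F 0| / t @[t --> 0^'+] --> nu & nu <= C.
  by rewrite F0 in lim; rewrite (cvg_lim _ lim).
have right_lim (G : R -> R) (l : R) : is_derive (0 : R) 1 G l ->
    t^-1 * (G t - G 0) @[t --> 0^'+] --> l.
  move=> [/cvg_ex [l' dl] E]; move: E; rewrite /derive (cvg_lim _ dl) // => E.
  rewrite E in dl; have := cvg_dnbhs_at_right dl.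
  apply: cvg_trans; apply: near_eq_cvg; near=> t.
  by rewrite /= addr0 [t%:A]mulr1.
have [hx0|hx0] := eqVneq (enorm (h x)) 0.
  have hx : h x = 0.
    apply/rowP => j; rewrite mxE; have := coord_sqr_le (h x) j.
    rewrite -enorm_sqr hx0 expr0n /= => le0; apply/eqP; rewrite -sqrf_eq0 eq_le le0 sqr_ge0 //.
  exists (enorm D).
    rewrite F0 hx0.
    have lim : Num.sqrt (\sum_j (t^-1 * (h (x + t *: w) 0 j - h x 0 j)) * (t^-1 * (h (x + t *: w) 0 j - h x 0 j))) @[t --> 0^'+] --> enorm D.
      rewrite enormE; apply: (@cvg_comp _ _ _ _ (@Num.sqrt R) _ (nbhs (dot D D))); last exact: sqrt_continuous.
      have := @cvg_sumr R _ _ (0^'+ : set_system R) _ (index_enum 'I_p) (fun j t => (t^-1 * (h (x + t *: w) 0 j - h x 0 j)) * (t^-1 * (h (x + t *: w) 0 j - h x 0 j))) (fun j => D 0 j * D 0 j); apply => j.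
      have : t^-1 * (h (x + t *: w) 0 j - h (x + 0 *: w) 0 j) @[t --> 0^'+] --> D 0 j.
        apply: (right_lim (fun t => h (x + t *: w) 0 j)).
        by apply: (@is_derive_line _ _ (fun y => h y 0 j)); rewrite scale0r addr0.
      by rewrite scale0r addr0 => L; exact: cvgM.
    apply: cvg_trans lim; apply: near_eq_cvg; near=> t.
    have t0 : 0 < t by near: t; exact: nbhs_right_gt.
    rewrite subr0 ger0_norm ?enorm_ge0 // /F enormE hx.
    rewrite (eq_bigr (fun j => t^-1 ^+ 2 * (h (x + t *: w) 0 j * h (x + t *: w) 0 j))).
      rewrite -mulr_sumr -/(dot (h (x + t *: w)) (h (x + t *: w))) sqrtrM ?sqr_ge0 // sqrtr_sqr.
      by rewrite gtr0_norm ?invr_gt0 // mulrC.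
    by move=> j _; rewrite mxE subr0; ring.
  have hxe e : dot (h x) e = enorm (h x) by rewrite hx0 hx dot0l.
  have C0 : 0 <= C.
    pose e : 'rV[R]_p := delta_mx 0 (Ordinal p0).
    apply: le_trans (boundD e _ (hxe e)) => //.
    rewrite /dot (bigD1 (Ordinal p0)) //= mxE !eqxx mulr1 big1 ?addr0 // => i ne.
    by rewrite mxE (negbTE ne) andbF mul0r.
  have [->//|D0] := eqVneq (enorm D) 0.
  have [e1 e2] := normalize D D0.
  by rewrite -[X in X <= _]e2; apply: le_trans (ler_norm _) (boundD _ e1 (hxe _)).
have [e1 e2] := normalize _ hx0.
set e := _ *: _ in e1 e2.
have a0 : 0 < enorm (h x) by rewrite lt_neqAle eq_sym hx0 enorm_ge0.
exists `|dot D e|; last exact: boundD.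
have dF : is_derive (0 : R) 1 F (dot D e).
  have Q := C1on_curve (gam := fun t => h (x + t *: w)) (y := h x) openT (C1on_nsq (A := setT)) I.
  have {}Q : is_derive (0 : R) 1 (fun t => dot (h (x + t *: w)) (h (x + t *: w))) (\sum_k 2 * h x 0 k * D 0 k).
    apply: Q; first by rewrite scale0r addr0.
    by move=> k; apply: (@is_derive_line _ _ (fun y => h y 0 k)); rewrite scale0r addr0.
  have pos : 0 < dot (h (x + (0 : R) *: w)) (h (x + (0 : R) *: w)).
    by rewrite scale0r addr0 -enorm_sqr exprn_gt0.
  have := @is_derive1_comp R Num.sqrt (fun t => dot (h (x + t *: w)) (h (x + t *: w))) 0 _ _ (is_derive1_sqrt pos) Q.
  rewrite (_ : Num.sqrt \o _ = F); last by apply/funext => t; rewrite /F enormE.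
  move=> H; apply: (@is_derive_eq _ _ _ _ _ _ _ _ H).
  rewrite scale0r addr0 -enormE /e dotZr [dot D _]dotC /dot.
  rewrite (eq_bigr (fun k => 2 * (h x 0 k * D 0 k))); last by move=> k _; ring.
  by rewrite -mulr_sumr; field.
have L : `|t^-1 * (F t - F 0)| @[t --> 0^'+] --> `|dot D e|.
  exact: cvg_norm (right_lim _ _ dF).
apply: cvg_trans L; apply: near_eq_cvg; near=> t.
have t0 : 0 < t by near: t; exact: nbhs_right_gt.
by rewrite normrM gtr0_norm ?invr_gt0 // mulrC.
Unshelve. all: by end_near. Qed.

End AbsGrad.

Section Main.
Context {R : realType} {m p : nat}.
Local Notation n := m.+3.
Variable h : 'rV[R]_n -> 'rV[R]_p.
Hypothesis p0 : (0 < p)%N.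
Hypothesis hball : forall x, eball x -> eball (h x).
Hypothesis Ch : forall j, Ck_on 2 eball (fun x => h x 0 j).

Let C1 j := (C1on_of_Ck (Ch j)).1.
Let C2 j := (C1on_of_Ck (Ch j)).2.

Variable e : 'rV[R]_p.
Hypothesis e1 : dot e e = 1.

Definition comp_grad k x := \sum_j partial k (fun y => h y 0 j) x * e 0 j.
Definition comp_hess k i x := \sum_j partial i (partial k (fun y => h y 0 j)) x * e 0 j.

Lemma comp_C1 : C1on (ballr 1) (fun x => dot (h x) e) comp_grad.
Proof.
refine (C1on_ext (C1on_sum (index_enum 'I_p) (fun j => C1onM (C1 j) (C1on_cst (A := ballr 1) (e 0 j)))) _ _) => // i y.
by apply: eq_bigr => j _; rewrite mulr0 addr0.
Qed.

Lemma comp_C2 k : C1on (ballr 1) (comp_grad k) (comp_hess k).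
Proof.
refine (C1on_ext (C1on_sum (index_enum 'I_p) (fun j => C1onM (C2 j k) (C1on_cst (A := ballr 1) (e 0 j)))) _ _) => // i y.
by apply: eq_bigr => j _; rewrite mulr0 addr0.
Qed.

Lemma comp_lt1 x : ballr 1 x -> `|dot (h x) e| < 1.
Proof.
move=> /eballE /hball /eballE; have := dot_CS (h x) e; rewrite e1 mulr1 => a b.
have : dot (h x) e ^+ 2 < 1 by exact: le_lt_trans a b.
by rewrite -real_normK ?num_real // expr_lt1.
Qed.

Lemma comp_laplacian y : \sum_k comp_hess k k y = \sum_j laplacian (fun x => h x 0 j) y * e 0 j.
Proof.
by rewrite exchange_big /=; apply: eq_bigr => j _; rewrite mulr_suml.
Qed.

Lemma comp_harmonic_bound x w : (forall j y, eball y -> laplacian (fun x => h x 0 j) y = 0) ->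
  eball x -> dot w w = 1 ->
  \sum_k comp_grad k x * w 0 k <= n%:R * moment_bound n (dot (h x) e) / (1 - enorm x).
Proof.
move=> lap /eballE Ax w1.
have ub y : ballr 1 y -> `|dot (h y) e| <= 1 by move=> /comp_lt1 /ltW.
apply: (gradient_bound_harmonic comp_C1 comp_C2 ub _ Ax w1 (comp_lt1 Ax)) => y /eballE Ay.
by rewrite comp_laplacian big1 // => j _; rewrite lap // mul0r.
Qed.

Lemma comp_hyp_harmonic_bound x w : (forall j y, eball y -> hyp_laplacian (fun x => h x 0 j) y = 0) ->
  eball x -> dot w w = 1 ->
  \sum_k comp_grad k x * w 0 k <=
  (n%:R + 1 * (n%:R - 2)) * moment_bound n (dot (h x) e) / (1 - enorm x ^+ 2).
Proof.
move=> lap /eballE Ax w1.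
have ub y : ballr 1 y -> `|dot (h y) e| <= 1 by move=> /comp_lt1 /ltW.
have pde y : ballr 1 y -> (1 - dot y y) * \sum_k comp_hess k k y
    + 2 * (n%:R - 2) * \sum_k y 0 k * comp_grad k y = 0.
  move=> Ay; have nz : 1 - dot y y != 0 by rewrite subr_eq0 gt_eqF.
  apply: (mulfI nz); rewrite mulr0 comp_laplacian.
  have -> : \sum_k y 0 k * comp_grad k y = \sum_j (\sum_k y 0 k * partial k (fun x => h x 0 j) y) * e 0 j.
    under eq_bigr do rewrite mulr_sumr.
    rewrite exchange_big /=; apply: eq_bigr => j _; rewrite mulr_suml.
    by apply: eq_bigr => k _; rewrite mulrA.
  rewrite !mulr_sumr -big_split /= mulr_sumr; apply: big1 => j _.
  have /eballE Ey := Ay; have := lap j y Ey; rewrite /hyp_laplacian enorm_sqr => l.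
  have := congr1 (fun t => t * e 0 j) l; rewrite /= mul0r => le.
  by apply: etrans le; ring.
have [x0|x0] := eqVneq (dot x x) 0.
  have -> : x = 0.
    apply/rowP => j; rewrite mxE; have := coord_sqr_le x j.
    by rewrite x0 => le0; apply/eqP; rewrite -sqrf_eq0 eq_le le0 sqr_ge0.
  have := gradient_bound_centre (kap := 1) _ comp_C1 comp_C2 _ w1 ub (comp_lt1 _).
  rewrite enorm_sqr dot0l subr0 divr1; apply.
  - by rewrite ler01 lexx.
  - by move=> y /pde; rewrite mul1r mulr1.
  - by rewrite /ballr /= dot0l ltr01.
have xp : 0 < dot x x by rewrite lt_neqAle eq_sym x0 dot_ge0.
pose b := (dot x x)^-1 *: x.
have bb : dot b b = (dot x x)^-1 by rewrite /b dotZl dotZr mulVf ?mulr1.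
have bb1 : 1 < dot b b by rewrite bb invf_gt1.
have xE : (dot b b)^-1 *: b = x by rewrite bb invrK /b scalerA mulfV // scale1r.
have := gradient_bound_inversion comp_C1 comp_C2 ub bb1 (w := w) pde w1.
rewrite xE bb invrK enorm_sqr; apply; exact: comp_lt1.
Qed.

End Main.

Unset Implicit Arguments.

Theorem theorem2p8 (R : realType) (n m : nat) (hn : (3 <= n)%N)
    (hm : (1 <= m)%N) (h : 'rV[R]_n -> 'rV[R]_m)
    (hball : forall x, eball x -> eball (h x)) :
  (vharmonic h -> forall x, eball x ->
     let bound := n%:R / 2 * ((1 - enorm (h x) ^+ 2) / (1 - enorm x)) in
     (abs_grad_norm h x <= bound%:E)%E /\
     ((4 <= n)%N -> (abs_grad_norm h x < bound%:E)%E)) /\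
  (vhyp_harmonic h -> forall x, eball x ->
     let bound :=
       (n%:R - 1) * ((1 - enorm (h x) ^+ 2) / (1 - enorm x ^+ 2)) in
     (abs_grad_norm h x <= bound%:E)%E /\
     ((4 <= n)%N -> (abs_grad_norm h x < bound%:E)%E)).
Proof.
have bounds (N lam a : R) (x : 'rV[R]_n) : 0 < N -> 0 < lam -> `|a| < 1 ->
    (abs_grad_norm h x <= (N * moment_bound n a / lam)%:E)%E ->
    (abs_grad_norm h x <= (N / 2 * ((1 - a ^+ 2) / lam))%:E)%E /\
    ((4 <= n)%N -> (abs_grad_norm h x < (N / 2 * ((1 - a ^+ 2) / lam))%:E)%E).
  move=> N0 l0 a1 le.
  have e : N / 2 * ((1 - a ^+ 2) / lam) = N * ((1 - a ^+ 2) / 2) / lam.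
    by field; rewrite gt_eqF.
  rewrite e; split=> [|n4].
    apply: le_trans le _; rewrite lee_fin ler_pM2r ?invr_gt0 // ler_pM2l //.
    exact: moment_bound_le.
  apply: le_lt_trans le _; rewrite lte_fin ltr_pM2r ?invr_gt0 // ltr_pM2l //.
  exact: moment_bound_lt.
case: n hn h hball bounds => [|[|[|k]]] // hn h hball bounds.
have nR : (3 : R) <= k.+3%:R by rewrite (ler_nat R 3).
split=> harm x Ax bound; have Ch j : Ck_on 2 eball (fun y => h y 0 j) by have [] := harm j.
all: have x1 : enorm x < 1 := Ax.
all: have hx1 : enorm (h x) < 1 := hball _ Ax.
all: have x0 := enorm_ge0 x.
all: have a1 : `|enorm (h x)| < 1 by rewrite ger0_norm ?enorm_ge0.
all: have C1 j := (C1on_of_Ck (Ch j)).1.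
all: have Ax' := (eballE x).1 Ax.
  apply: bounds => //; first by rewrite subr_gt0.
  apply: abs_grad_norm_le => // e w e1 w1 he; rewrite -he.
  apply: comp_harmonic_bound => // j y Ay.
  by have [_] := harm j; exact.
have -> : bound = (k.+3%:R + 1 * (k.+3%:R - 2)) / 2 * ((1 - enorm (h x) ^+ 2) / (1 - enorm x ^+ 2)).
  by rewrite /bound; congr (_ * _); field.
have N0 : 0 < k.+3%:R + 1 * (k.+3%:R - 2) :> R by lra.
have l0 : 0 < 1 - enorm x ^+ 2 by rewrite subr_gt0 expr_lt1.
apply: (bounds _ _ _ _ N0 l0 a1).
apply: abs_grad_norm_le => // e w e1 w1 he; rewrite -he.
apply: comp_hyp_harmonic_bound => // j y Ay.
by have [_] := harm j; exact.
Qed.
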